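(* Let $\mathcal{X}$ be a finite set, $\mathcal{H}$ a finite-dimensional Hilbert space, and $W:\mathcal{X}\to\mathcal{S}(\mathcal{H})$, $x\mapsto W_x$, a classical-quantum channel. Then for every $\epsilon\in(0,1)$, \[ R(W)=R_\epsilon(W)=C(W):=\sup_{p\in\mathcal{P}(\mathcal{X})} I(X;B)_{W\times p}. \]
   Context: $\mathcal{S}(\mathcal{H})$ is the set of density matrices on $\mathcal{H}$ and $\mathcal{P}(\mathcal{X})$ the set of probability distributions on $\mathcal{X}$. For $p\in\mathcal{P}(\mathcal{X})$, $W(p):=\sum_x p(x)W_x$ and $I(X;B)_{W\times p}:=\sum_x p(x)D(W_x\|W(p))$, where $D(\rho\|\sigma)=\mathrm{Tr}\,\rho(\log\rho-\log\sigma)$; all logarithms are base 2. For $n\ge1$ and $x^n=(x_1,\dots,x_n)\in\mathcal{X}^n$ let $W^{\otimes n}_{x^n}:=W_{x_1}\otimes\cdots\otimes W_{x_n}$ and, for a distribution $p^n$ on $\mathcal{X}^n$, $W^{\otimes n}(p^n):=\sum_{x^n}p^n(x^n)W^{\otimes n}_{x^n}$. For a positive integer $M$, $\mathcal{P}_M(\mathcal{X}^n)$ is the set of distributions $q$ on $\mathcal{X}^n$ with $Mq(x^n)\in\mathbb{Z}$ for all $x^n$. Define the worst-case resolution error \[ \varepsilon(W^{\otimes n},M):=\sup_{p^n\in\mathcal{P}(\mathcal{X}^n)}\inf_{q^n\in\mathcal{P}_M(\mathcal{X}^n)}\tfrac12\|W^{\otimes n}(p^n)-W^{\otimes n}(q^n)\|_1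 . \] The worst-input resolvability rate is $R(W):=\inf\{R>0:\ \forall\gamma>0,\ \liminf_{n\to\infty}\varepsilon(W^{\otimes n},\lfloor 2^{n(R+\gamma)}\rfloor)=0\}$. For $\epsilon\in(0,1)$, $M_\epsilon(W^{\otimes n}):=\min\{M\in\mathbb{N}_+:\varepsilon(W^{\otimes n},M)\le\epsilon\}$ and $R_\epsilon(W):=\liminf_{n\to\infty}\frac1n\log M_\epsilon(W^{\otimes n})$. *)

(* Defs.v *)
From HB Require Import structures.
From mathcomp Require Import all_boot all_order all_algebra.
From mathcomp Require Import all_classical all_reals all_analysis.
From mathcomp Require Import complex mxtens.
Set Implicit Arguments. Unset Strict Implicit. Unset Printing Implicit Defensive.
Import Order.TTheory GRing.Theory Num.Theory.
Local Open Scope ring_scope.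
Local Open Scope classical_set_scope.
Local Open Scope complex_scope.

Section QDefs.
Variable R : realType.
Local Notation C := (R[i]).

Definition adj m n (A : 'M[C]_(m, n)) : 'M[C]_(n, m) := map_mx (@conjc R) A^T.

Definition psd d (A : 'M[C]_d) : Prop :=
  forall v : 'cV[C]_d, 0 <= (adj v *m A *m v) 0 0.
Definition density d (A : 'M[C]_d) : Prop := psd A /\ \tr A = 1.

Definition spec_dec d (A : 'M[C]_d) (U : 'M[C]_d) (l : 'rV[R]_d) : Prop :=
  U *m adj U = 1%:M /\
  A = U *m diag_mx (map_mx (fun r => r%:C) l) *m adj U.

Definition hfun d (f : R -> R) (A : 'M[C]_d) : 'M[C]_d :=
  match pselect (exists Ul : 'M[C]_d * 'rV[R]_d, spec_dec A Ul.1 Ul.2) with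
  | left h => let Ul := projT1 (cid h) in
      Ul.1 *m diag_mx (map_mx (fun r => (f r)%:C) Ul.2) *m adj Ul.1
  | right _ => 0
  end.

Definition log2 (x : R) : R := ln x / ln 2.
Definition mlog d (A : 'M[C]_d) : 'M[C]_d :=
  hfun (fun t => if t == 0 then 0 else log2 t) A.

(* quantum relative entropy, +oo unless supp rho <= supp sigma *)
Definition relent d (rho sigma : 'M[C]_d) : \bar R :=
  if `[< forall v : 'cV[C]_d, sigma *m v = 0 -> rho *m v = 0 >]
  then (@complex.Re R (\tr (rho *m (mlog rho - mlog sigma))))%:E
  else +oo%E.

Definition trnorm d (A : 'M[C]_d) : R := @complex.Re R (\tr (hfun Num.sqrt (adj A *m A))).

Definition prob (T : finType) : set {ffun T -> R} :=
  [set p | (forall t, 0 <= p t) /\ \sum_t p t = 1].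
Arguments prob T : clear implicits.
Definition probM (T : finType) (M : nat) : set {ffun T -> R} :=
  [set q | prob T q /\ forall t, (M%:R * q t) \is a Num.int].
Arguments probM T M : clear implicits.

Variable X : finType.
Variable d : nat.

Definition avg (W : X -> 'M[C]_d) (p : {ffun X -> R}) : 'M[C]_d :=
  \sum_x (p x)%:C *: W x.

Definition mutinf (W : X -> 'M[C]_d) (p : {ffun X -> R}) : \bar R :=
  (\sum_(x : X) (p x)%:E * relent (W x) (avg W p))%E.

Definition capacity (W : X -> 'M[C]_d) : \bar R :=
  ereal_sup [set mutinf W p | p in prob X].

Fixpoint tens_fam (n : nat) : ('I_n -> 'M[C]_d) -> 'M[C]_(d ^ n) :=
  match n return ('I_n -> 'M[C]_d) -> 'M[C]_(d ^ n) with
  | 0 => fun _ => castmx (esym (expn0 d), esym (expn0 d)) 1%:M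
  | n'.+1 => fun g => castmx (esym (expnS d n'), esym (expnS d n'))
                         (tensmx (g ord0) (tens_fam (fun i => g (lift ord0 i))))
  end.

Definition Wn (W : X -> 'M[C]_d) (n : nat) (xn : {ffun 'I_n -> X}) : 'M[C]_(d ^ n) :=
  tens_fam (fun i => W (xn i)).

Definition avgn (W : X -> 'M[C]_d) (n : nat) (pn : {ffun {ffun 'I_n -> X} -> R})
  : 'M[C]_(d ^ n) := \sum_xn (pn xn)%:C *: Wn W xn.

Definition res_err (W : X -> 'M[C]_d) (n M : nat) : R :=
  sup [set inf [set trnorm (avgn W pn - avgn W qn) / 2 | qn in probM {ffun 'I_n -> X} M]
      | pn in prob {ffun 'I_n -> X}].

(* worst-input resolvability rate R(W) (liminf taken over n >= 1) *)
Definition res_rate (W : X -> 'M[C]_d) : \bar R :=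
  ereal_inf [set r%:E | r in [set r : R | 0 < r /\ forall g : R, 0 < g ->
     limn_einf (fun n => (res_err W n.+1
        (Num.truncn (2 `^ (n.+1%:R * (r + g)))))%:E) = 0%E]].

Definition Meps (W : X -> 'M[C]_d) (eps : R) (n : nat) : nat :=
  match pselect (exists M : nat, (0 < M)%N /\ res_err W n M <= eps) with
  | left h => ex_minn (P := fun M => `[< (0 < M)%N /\ res_err W n M <= eps >])
               (let: ex_intro M HM := h in ex_intro _ M (asboolT HM))
  | right _ => 0%N
  end.

(* R_eps(W) (liminf taken over n >= 1) *)
Definition res_rate_eps (W : X -> 'M[C]_d) (eps : R) : \bar R :=
  limn_einf (fun n => (log2 (Meps W eps n.+1)%:R / n.+1%:R)%:E).

End QDefs.

(* Main.v *)
Require Import Defs.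
From HB Require Import structures.
From mathcomp Require Import all_boot all_order all_algebra.
From mathcomp Require Import all_classical all_reals all_analysis.
From mathcomp Require Import complex mxtens.
From mathcomp Require Import spectral.
From mathcomp Require Import ring lra zify.
Import Order.TTheory GRing.Theory Num.Theory.
Local Open Scope ring_scope.
Set Implicit Arguments. Unset Strict Implicit. Unset Printing Implicit Defensive.

(** Both rates are squeezed against the capacity [C], the supremum of the Holevo
    quantities.

    Achievability.  Split an arbitrary input law on [X^n] according to the
    (polynomially many) types.  For inputs of type [P], cutting [W^n_{x^n}] to
    its eigenvalues at most [2^(-n(H(B|P) - D))] and compressing it by the
    typical projection of [W(P)^{(x)n}], whose rank is at most
    [2^(n(H(W(P)) + D))], changes little, by Chebyshev's inequality and gentle
    measurement.  For [M] independent samples, the Hilbert-Schmidt variance of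
    the compressed states and Cauchy-Schwarz on the range of the projection
    bound the trace distance by about [2^(n (I(P) + 2D) / 2) / sqrt M], and
    [I(P) <= C] since [P] is itself an input law.

    Strong converse.  Let [rho_f] be the uniform mixture of [N] output states
    whose inputs are drawn independently from [p^n], and fix one candidate
    [om = W^n(q)].  If [rho_f] and [om] are not almost orthogonal, then [rho_f]
    must have constant weight on the spectral projection [Q = {om >= tau}]: the
    part of [om] outside [Q] has eigenvalues below [tau], while [rho_f]
    essentially lives on [N 2^(n H(B|X))] dimensions.  As [Q] has rank at most
    [1 / tau], much less than [2^(n H(B))], this weight has vanishing
    expectation, so by Chernoff's bound it is constant with probability at most
    [exp (- N / 2)].  A union bound over the at most [|X|^(n M)] laws [q] with
    denominator [M] leaves some [f] far from all of them as long as [N] exceeds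
    [n M], for any [N] exponentially below [2^(n I(p))]. *)

Section FiniteProbability.
Variable R : realType.
Implicit Types (T A I : finType).

Definition distr T (p : T -> R) : Prop :=
  (forall t, 0 <= p t) /\ \sum_t p t = 1.

Definition expect T (p F : T -> R) : R := \sum_t p t * F t.

Definition mass T (p : T -> R) (B : pred T) : R := \sum_(t | B t) p t.

Lemma distr_le1 T (p : T -> R) t : distr p -> p t <= 1.
Proof.
by case=> p0 p1; rewrite -p1 (bigD1 t) //= lerDl; apply: sumr_ge0 => u _.
Qed.

Lemma distr_gt0_exists T (p : T -> R) : distr p -> exists t, 0 < p t.
Proof.
move=> [p0 p1]; apply: contrapT => /forallNP np.
have /eqP := p1; rewrite big1 ?(eq_sym 0) ?oner_eq0 // => t _.
by apply/eqP; move/negP: (np t); rewrite lt_def p0 andbT negbK.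
Qed.

Lemma eq_expect T (p F G : T -> R) : F =1 G -> expect p F = expect p G.
Proof. by move=> FG; apply: eq_bigr => t _; rewrite FG. Qed.

Lemma expect_cst T (p : T -> R) c : distr p -> expect p (fun=> c) = c.
Proof. by move=> [_ p1]; rewrite /expect -mulr_suml p1 mul1r. Qed.

Lemma expectD T (p F G : T -> R) :
  expect p (fun t => F t + G t) = expect p F + expect p G.
Proof. by rewrite /expect -big_split; apply: eq_bigr => t _; rewrite mulrDr. Qed.

Lemma expectB T (p F G : T -> R) :
  expect p (fun t => F t - G t) = expect p F - expect p G.
Proof. by rewrite /expect -sumrB; apply: eq_bigr => t _; rewrite mulrBr. Qed.

Lemma expectZ T (p F : T -> R) c :
  expect p (fun t => c * F t) = c * expect p F.
Proof. by rewrite /expect mulr_sumr; apply: eq_bigr => t _; rewrite mulrCA. Qed.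

Lemma expect_sum T (p : T -> R) J (s : seq J) (F : J -> T -> R) :
  expect p (fun t => \sum_(j <- s) F j t) = \sum_(j <- s) expect p (F j).
Proof. by rewrite exchange_big; apply: eq_bigr => t _; rewrite mulr_sumr. Qed.

Lemma ler_expect T (p F G : T -> R) : distr p -> (forall t, F t <= G t) ->
  expect p F <= expect p G.
Proof. by move=> [p0 _] FG; apply: ler_sum => t _; rewrite ler_wpM2l. Qed.

Lemma expect_ge0 T (p F : T -> R) : distr p -> (forall t, 0 <= F t) ->
  0 <= expect p F.
Proof. by move=> dp F0; rewrite -(expect_cst 0 dp); apply: ler_expect. Qed.

Lemma expect_le T (p F : T -> R) c : distr p -> (forall t, F t <= c) ->
  expect p F <= c.
Proof. by move=> dp Fc; rewrite -[leRHS](expect_cst c dp); apply: ler_expect. Qed.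

Lemma ler_norm_expectB T (p F G : T -> R) c : distr p ->
  (forall t, `|F t - G t| <= c) -> `|expect p F - expect p G| <= c.
Proof.
move=> dp FGc; rewrite -expectB; apply: le_trans (ler_norm_sum _ _ _) _.
rewrite -[leRHS](expect_cst c dp); apply: ler_sum => t _.
by rewrite normrM ger0_norm ?ler_wpM2l //; case: dp.
Qed.

Lemma expect_le_exists T (p F : T -> R) c : distr p -> expect p F <= c ->
  exists t, F t <= c.
Proof.
move=> dp; have [t pt] := distr_gt0_exists dp; have [p0 _] := dp.
move=> leFc; apply: contrapT => /forallNP Fc.
have {}Fc u : c < F u by rewrite ltNge; apply/negP.
suff : 0 < expect p (fun t => F t - c).
  by rewrite expectB expect_cst // subr_gt0 ltNge leFc.
rewrite /expect (bigD1 t) //= ltr_wpDr ?mulr_gt0 ?subr_gt0 //.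
by apply: sumr_ge0 => u _; rewrite mulr_ge0 // subr_ge0 ltW.
Qed.

Lemma massE T (p : T -> R) B : mass p B = expect p (fun t => (B t)%:R).
Proof.
rewrite /mass big_mkcond; apply: eq_bigr => t _.
by case: (B t); rewrite ?mulr1 ?mulr0.
Qed.

Lemma ler_mass T (p : T -> R) (B B' : pred T) : (forall t, 0 <= p t) ->
  (forall t, 0 < p t -> B t -> B' t) -> mass p B <= mass p B'.
Proof.
move=> p0 sBB'; rewrite !massE; apply: ler_sum => t _.
have := p0 t; rewrite le_eqVlt => /predU1P[<-|pt]; first by rewrite !mul0r.
by rewrite ler_wpM2l // ler_nat; case: (B t) (sBB' t pt) => // ->.
Qed.

Lemma markov T (p F : T -> R) c : distr p -> (forall t, 0 <= F t) -> 0 < c ->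
  mass p (fun t => c <= F t) <= expect p F / c.
Proof.
move=> dp F0 c0; rewrite ler_pdivlMr // massE mulrC -expectZ.
by apply: ler_expect => // t; case: (leP c (F t)) => // ?; rewrite ?mulr1 ?mulr0.
Qed.

Definition prod_distr I A (v : I -> A -> R) (f : {ffun I -> A}) : R :=
  \prod_i v i (f i).

Lemma expect_prod I A (v F : I -> A -> R) :
  expect (prod_distr v) (fun f => \prod_i F i (f i)) =
  \prod_i expect (v i) (F i).
Proof.
by rewrite bigA_distr_bigA; apply: eq_bigr => f _; rewrite /prod_distr -big_split.
Qed.

Lemma distr_prod I A (v : I -> A -> R) :
  (forall i, distr (v i)) -> distr (prod_distr v).
Proof.
move=> dv; split=> [f|]; first by apply: prodr_ge0 => i _; case: (dv i).
by rewrite -bigA_distr_bigA big1 // => i _; case: (dv i).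
Qed.

Lemma expect_prod_coord2 I A (v Z : I -> A -> R) i j :
  (forall i, distr (v i)) -> (forall i, expect (v i) (Z i) = 0) ->
  expect (prod_distr v) (fun f => Z i (f i) * Z j (f j)) =
  if i == j then expect (v i) (fun a => Z i a ^+ 2) else 0.
Proof.
move=> dv Z0; pose F k a := (if k == i then Z k a else 1) *
                            (if k == j then Z k a else 1).
have one_coord (W : I -> R) k : \prod_l (if l == k then W l else 1) = W k.
  by rewrite -big_mkcond big_pred1_eq.
rewrite (@eq_expect _ _ _ (fun f : {ffun I -> A} => \prod_k F k (f k))) => [|f].
  rewrite expect_prod (bigD1 i) //= /F eqxx; have [->|ij] := eqVneq i j.
    rewrite [X in _ * X]big1 ?mulr1 // => k /negbTE ->.
    by rewrite mulr1 expect_cst.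
  by rewrite (eq_expect _ (fun a => mulr1 (Z i a))) Z0 mul0r.
by rewrite big_split /= !(one_coord (fun k => Z k (f k))).
Qed.

Lemma prod_distr_variance I A (v Z : I -> A -> R) : (forall i, distr (v i)) ->
  expect (prod_distr v)
    (fun f => (\sum_i Z i (f i) - \sum_i expect (v i) (Z i)) ^+ 2) <=
  \sum_i expect (v i) (fun a => Z i a ^+ 2).
Proof.
move=> dv; pose Y i a := Z i a - expect (v i) (Z i).
have Y0 i : expect (v i) (Y i) = 0 by rewrite expectB expect_cst // subrr.
rewrite (@eq_expect _ _ _ (fun f : {ffun I -> A} =>
    \sum_i \sum_j Y i (f i) * Y j (f j))); last first.
  by move=> f; rewrite -sumrB expr2 big_distrlr.
rewrite expect_sum; apply: ler_sum => i _; rewrite expect_sum (bigD1 i) //=.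
rewrite [X in _ + X]big1 => [|j ji]; last first.
  by rewrite expect_prod_coord2 // eq_sym (negbTE ji).
rewrite expect_prod_coord2 // eqxx addr0 -subr_ge0 -expectB.
rewrite (@eq_expect _ _ _ (fun a => 2 * expect (v i) (Z i) * Z i a -
                                    expect (v i) (Z i) ^+ 2)) => [|a].
  rewrite expectB expect_cst // expectZ -mulrA -expr2 mulr_natl mulr2n addrK.
  exact: sqr_ge0.
by rewrite /Y; ring.
Qed.

Lemma prod_distr_chebyshev I A (v Z : I -> A -> R) D : 0 < D ->
  (forall i, distr (v i)) ->
  mass (prod_distr v)
    (fun f => D <= `|\sum_i Z i (f i) - \sum_i expect (v i) (Z i)|) <=
  (\sum_i expect (v i) (fun a => Z i a ^+ 2)) / D ^+ 2.
Proof.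
move=> D0 dv; have dpv := distr_prod dv.
pose dev2 (f : {ffun I -> A}) :=
  (\sum_i Z i (f i) - \sum_i expect (v i) (Z i)) ^+ 2.
apply: (@le_trans _ _ (expect (prod_distr v) dev2 / D ^+ 2)); last first.
  by rewrite ler_pM2r ?invr_gt0 ?exprn_gt0 // prod_distr_variance.
apply: le_trans (markov dpv _ (exprn_gt0 2 D0)) => [|f]; last exact: sqr_ge0.
apply: ler_mass => [|f _ le_D]; first by case: dpv.
by rewrite -[leRHS]real_normK ?num_real // ler_pXn2r ?nnegrE // ltW.
Qed.

Definition joint_distr A (B : finType) (p : A -> R) (q : A -> B -> R)
    (ab : A * B) : R :=
  p ab.1 * q ab.1 ab.2.

Lemma expect_joint A (B : finType) (p : A -> R) (q : A -> B -> R) F :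
  expect (joint_distr p q) F = expect p (fun a => expect (q a) (fun b => F (a, b))).
Proof.
rewrite /expect; under [RHS]eq_bigr do rewrite mulr_sumr.
by rewrite pair_bigA; apply: eq_bigr => -[a b] _; rewrite mulrA.
Qed.

Lemma distr_joint A (B : finType) (p : A -> R) (q : A -> B -> R) :
  distr p -> (forall a, distr (q a)) -> distr (joint_distr p q).
Proof.
move=> dp dq; split=> [ab|].
  by rewrite mulr_ge0 //; [case: dp | case: (dq ab.1)].
transitivity (expect (joint_distr p q) (fun=> 1)).
  by apply: eq_bigr => ab _; rewrite mulr1.
rewrite expect_joint -[RHS](expect_cst 1 dp); apply: eq_expect => a.
exact: expect_cst.
Qed.

Lemma expect_prod_joint I A (B : finType) (p : I -> A -> R) (q : I -> A -> B -> R)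
    (F : {ffun I -> A * B} -> R) :
  expect (prod_distr (fun i => joint_distr (p i) (q i))) F =
  expect (prod_distr p) (fun f => expect (prod_distr (fun i => q i (f i)))
    (fun g => F [ffun i => (f i, g i)])).
Proof.
pose zip (fg : {ffun I -> A} * {ffun I -> B}) := [ffun i => (fg.1 i, fg.2 i)].
have zip_bij : bijective zip.
  exists (fun h : {ffun I -> A * B} => ([ffun i => (h i).1], [ffun i => (h i).2])).
    by case=> f g; congr (_, _); apply/ffunP => i; rewrite !ffunE.
  by move=> h; apply/ffunP => i; rewrite !ffunE; case: (h i).
rewrite /expect; under [RHS]eq_bigr do rewrite mulr_sumr.
rewrite pair_bigA (reindex zip) /=; last exact: onW_bij.
apply: eq_bigr => -[f g] _; rewrite mulrA /prod_distr -big_split /=.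
by congr (_ * _); apply: eq_bigr => i _; rewrite ffunE.
Qed.

End FiniteProbability.

Section Log2.
Variable R : realType.
Implicit Types x y : R.

Lemma ln2_gt0 : 0 < ln 2 :> R. Proof. by rewrite ln_gt0 // ltr1n. Qed.

Lemma pow2_gt0 x : 0 < 2 `^ x. Proof. by rewrite powR_gt0. Qed.

Lemma pow2D x y : 2 `^ (x + y) = 2 `^ x * 2 `^ y.
Proof. by rewrite powRD // pnatr_eq0 implybT. Qed.

Lemma pow2E x : 2 `^ x = expR (x * ln 2).
Proof. by rewrite /powR pnatr_eq0. Qed.

Lemma ler_pow2 x y : (2 `^ x <= 2 `^ y) = (x <= y).
Proof. by rewrite !pow2E ler_expR ler_pM2r // ln2_gt0. Qed.

Lemma pow2_log2 x : 0 < x -> 2 `^ log2 x = x.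
Proof. by move=> x0; rewrite pow2E /log2 divfK ?gt_eqF ?ln2_gt0 // lnK. Qed.

Lemma ler_log2_pow2 x y : 0 < x -> (log2 x <= y) = (x <= 2 `^ y).
Proof. by move=> x0; rewrite -{2}(pow2_log2 x0) ler_pow2. Qed.

Lemma prod_pow2_log2 (I : finType) (F : I -> R) : (forall i, 0 < F i) ->
  \prod_i F i = 2 `^ (\sum_i log2 (F i)).
Proof.
move=> F0; elim/big_rec2: _ => [|i x y _ ->]; first by rewrite powRr0.
by rewrite pow2D pow2_log2.
Qed.

Lemma log2_le0 x : x <= 1 -> log2 x <= 0.
Proof. by move=> x1; rewrite /log2 pmulr_lle0 ?invr_gt0 ?ln2_gt0 // ln_le0. Qed.

Definition log2sq_max : R := 4 / ln 2 ^+ 2.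

Lemma log2sq_max_ge0 : 0 <= log2sq_max. Proof. by rewrite divr_ge0 // sqr_ge0. Qed.

Lemma mulrN_ln_le1 x : 0 < x -> x * - ln x <= 1 - x.
Proof.
move=> x0; have : ln x^-1 <= x^-1 - 1.
  have := @le_ln1Dx R (x^-1 - 1); rewrite [1 + _]addrC subrK; apply.
  by rewrite ltrBrDl subrr invr_gt0.
by rewrite lnV ?posrE // -(ler_pM2l x0) mulrBr mulr1 mulfV ?gt_eqF.
Qed.

(* [t (ln t)^2 = 4 (u ln u)^2] for [u = sqrt t]. *)
Lemma mul_log2_sqr_le x : 0 <= x <= 1 -> x * log2 x ^+ 2 <= log2sq_max.
Proof.
move=> /andP[]; rewrite le_eqVlt => /predU1P[<-|x0] x1.
  by rewrite mul0r log2sq_max_ge0.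
pose u := Num.sqrt x; have u0 : 0 < u by rewrite sqrtr_gt0.
have xu : x = u ^+ 2 by rewrite sqr_sqrtr // ltW.
have u1 : u <= 1 by rewrite -sqrtr1 ler_sqrt.
rewrite /log2 expr_div_n mulrA ler_pM2r ?invr_gt0 ?exprn_gt0 ?ln2_gt0 //.
have -> : x * ln x ^+ 2 = 4 * (u * - ln u) ^+ 2 by rewrite xu lnXn //; ring.
have ulnu_le1 : u * - ln u <= 1.
  by apply: le_trans (mulrN_ln_le1 u0) _; rewrite gerBl ltW.
have ulnu_ge0 : 0 <= u * - ln u by rewrite mulr_ge0 ?oppr_ge0 ?ln_le0 // ltW.
by rewrite -[leRHS]mulr1 ler_pM2l // expr_le1.
Qed.

Lemma expR_le_slope x b : 0 <= x <= b -> expR x <= 1 + x * expR b.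
Proof.
move=> /andP[x0 xb]; have : expR x * (1 - x) <= 1.
  rewrite -[leRHS](expRxMexpNx_1 x) ler_pM2l ?expR_gt0 //; exact: expR_ge1Dx.
rewrite mulrBr mulr1 lerBlDr mulrC => /le_trans; apply.
by rewrite lerD2l ler_wpM2l // ler_expR.
Qed.

Lemma natrX_le_expR (k m : nat) : (k ^ m)%:R <= expR (k%:R * m%:R) :> R.
Proof.
rewrite natrX expRM_natr lerXn2r ?nnegrE ?expR_ge0 //.
by apply: le_trans (expR_ge1Dx _); rewrite lerDr.
Qed.

End Log2.

Section Typicality.
Variable R : realType.
Implicit Types (T A I : finType).

Definition typical (m D x : R) : bool := 2 `^ (m - D) <= x <= 2 `^ (m + D).

Lemma prod_distr_typical I A (v w : I -> A -> R) D : 0 < D ->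
  (forall i, distr (v i)) -> (forall i a, 0 <= w i a) ->
  (forall i a, w i a = 0 -> v i a = 0) ->
  mass (prod_distr v) (fun f => ~~ typical
    (\sum_i expect (v i) (fun a => log2 (w i a))) D (\prod_i w i (f i))) <=
  (\sum_i expect (v i) (fun a => log2 (w i a) ^+ 2)) / D ^+ 2.
Proof.
move=> D0 dv w0 wv; set m := \sum_i _.
apply: le_trans (prod_distr_chebyshev (fun i a => log2 (w i a)) D0 dv).
apply: ler_mass => [|f]; first by case: (distr_prod dv).
rewrite lt_neqAle eq_sym => /andP[/prodf_neq0 vf _].
have wf i : 0 < w i (f i).
  by rewrite lt_neqAle w0 andbT eq_sym; apply: contra_neq (vf i isT) => /wv.
rewrite /typical prod_pow2_log2 // !ler_pow2 -/m negb_and -!ltNge.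
by rewrite ler_normr => /orP[|] m_far; apply/orP; [right | left]; lra.
Qed.

End Typicality.

Section Sampling.
Variable R : realType.
Implicit Types (T : finType) (N M : nat).

Definition empirical T M (f : {ffun 'I_M -> T}) : {ffun T -> R} :=
  [ffun x => (\sum_i (f i == x)%:R) / M%:R].

Lemma sum_empirical T M (f : {ffun 'I_M -> T}) (V : lmodType R) (z : T -> V) :
  \sum_x empirical f x *: z x = M%:R^-1 *: \sum_i z (f i).
Proof.
rewrite scaler_sumr.
under eq_bigr => x _ do rewrite ffunE mulrC -scalerA scaler_suml scaler_sumr.
rewrite exchange_big; apply: eq_bigr => i _ /=.
rewrite -scaler_sumr; congr (_ *: _).
rewrite (bigD1 (f i)) //= eqxx scale1r big1 ?addr0 // => x /negbTE.
by rewrite eq_sym => ->; rewrite scale0r.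
Qed.

Lemma expect_empirical T M (f : {ffun 'I_M -> T}) (z : T -> R) :
  expect (empirical f) z = (\sum_i z (f i)) / M%:R.
Proof. by rewrite [RHS]mulrC -[RHS](sum_empirical f (z : T -> R^o)). Qed.

Lemma empirical_gt0 T M (f : {ffun 'I_M -> T}) i : 0 < empirical f (f i).
Proof.
have M0 : (0 < M)%N by apply: leq_ltn_trans (ltn_ord i).
rewrite ffunE divr_gt0 ?ltr0n // (bigD1 i) //= eqxx.
by rewrite ltr_pwDl // sumr_ge0.
Qed.

Lemma empirical_probM T M (f : {ffun 'I_M -> T}) :
  (0 < M)%N -> probM M (empirical f).
Proof.
move=> M0; have Mn0 : M%:R != 0 :> R by rewrite pnatr_eq0 -lt0n.
split; first split.
- by move=> x; rewrite ffunE divr_ge0 // sumr_ge0.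
- have := expect_empirical f (fun=> 1); rewrite /expect.
  under eq_bigr do rewrite mulr1; move=> ->.
  by rewrite sumr_const card_ord mulfV.
- move=> x; rewrite ffunE mulrC divfK //.
  by apply: rpred_sum => i _; case: eqP => _; rewrite ?rpred1 ?rpred0.
Qed.

Lemma prob_empirical T M (f : {ffun 'I_M -> T}) : (0 < M)%N -> prob (empirical f).
Proof. by move=> M0; case: (empirical_probM f M0). Qed.

Lemma exists_count_mem T (k : T -> nat) :
  exists s : seq T, forall x, count_mem x s = k x.
Proof.
exists (flatten [seq nseq (k x) x | x <- enum T]) => x.
rewrite count_flatten sumnE -map_comp big_map big_enum /= (bigD1 x) //=.
rewrite count_nseq /= eqxx mul1n big1 ?addn0 // => y /negbTE yx.
by rewrite count_nseq /= yx mul0n.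
Qed.

Lemma probM_empirical T M (q : {ffun T -> R}) : (0 < M)%N -> probM M q ->
  exists f : {ffun 'I_M -> T}, q = empirical f.
Proof.
move=> M0 [dq qM]; have Mn0 : M%:R != 0 :> R by rewrite pnatr_eq0 -lt0n.
have /choice[k Mq] x : exists k : nat, M%:R * q x = k%:R.
  by apply/natrP; rewrite -intrEge0 ?qM // mulr_ge0 //; case: dq.
have [s sk] := exists_count_mem k.
have size_s : size s = M.
  apply/eqP; rewrite -(eqr_nat R) -sum1_size (partition_big id xpredT) //= natr_sum.
  rewrite (eq_bigr (fun x => M%:R * q x)) => [|x _].
    by rewrite -mulr_sumr; case: dq => _ ->; rewrite mulr1.
  by rewrite sum1_count sk Mq.
have [x0 _] := distr_gt0_exists dq.
exists [ffun i : 'I_M => nth x0 s i]; apply/ffunP => x; rewrite ffunE.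
apply: (mulfI Mn0); rewrite Mq mulrC divfK // -sk -sumn_count sumnE big_map.
rewrite (big_nth x0) size_s big_mkord natr_sum; apply: eq_bigr => i _.
by rewrite ffunE.
Qed.

Lemma empirical_mean_variance T M (p z : T -> R) : (0 < M)%N -> distr p ->
  expect (prod_distr (fun _ : 'I_M => p))
    (fun f => (expect p z - expect (empirical f) z) ^+ 2) <=
  expect p (fun x => z x ^+ 2) / M%:R.
Proof.
move=> M0 dp; have Mp : 0 < M%:R :> R by rewrite ltr0n.
have := @prod_distr_variance R _ _ (fun _ : 'I_M => p) (fun=> z) (fun=> dp).
rewrite !sumr_const card_ord => var_le.
rewrite ler_pdivlMr // -(ler_pM2r Mp) -mulrA -expr2 mulrC -expectZ mulr_natr.
apply: le_trans var_le; apply: ler_expect => [|f]; first exact: distr_prod.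
rewrite -exprMn expect_empirical mulrBr [X in _ - X]mulrC divfK ?gt_eqF //.
by rewrite mulr_natl -sqrrN opprB.
Qed.

Section Chernoff.
Variables (T : finType) (N : nat) (p a : T -> R) (b mu eta : R).
Hypothesis dp : distr p.
Hypothesis a_ge0_le : forall x, 0 <= a x <= b.
Hypothesis mean_a : expect p a <= mu.
Hypothesis eta0 : 0 < eta.
Hypothesis mu_small : mu * expR (b / eta) <= eta / 2.

Lemma expect_expR_le : expect p (fun x => expR (a x / eta)) <= expR (1 / 2).
Proof.
apply: (@le_trans _ _ (expect p (fun x => 1 + expR (b / eta) / eta * a x))).
  apply: ler_expect => // x; have /andP[ax0 axb] := a_ge0_le x.
  have -> : expR (b / eta) / eta * a x = a x / eta * expR (b / eta) by ring.
  by apply: expR_le_slope; rewrite divr_ge0 ?(ltW eta0) //= ler_pM2r ?invr_gt0.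
rewrite expectD expect_cst // expectZ; apply: le_trans (expR_ge1Dx _).
rewrite lerD2l; apply: (@le_trans _ _ (expR (b / eta) / eta * mu)).
  by rewrite ler_wpM2l // divr_ge0 ?expR_ge0 // ltW.
by rewrite mulrC mulrA ler_pdivrMr //; have := mu_small; lra.
Qed.

Lemma sample_mean_tail :
  mass (prod_distr (fun _ : 'I_N => p)) (fun f => N%:R * eta <= \sum_i a (f i)) <=
  expR (- (N%:R / 2)).
Proof.
have dpN := distr_prod (fun _ : 'I_N => dp).
pose Z (f : {ffun 'I_N -> T}) := \prod_i expR (a (f i) / eta).
have ZE f : Z f = expR ((\sum_i a (f i)) / eta) by rewrite /Z mulr_suml expR_sum.
apply: (@le_trans _ _ (expect (prod_distr (fun _ : 'I_N => p)) Z / expR N%:R)).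
  apply: le_trans (markov dpN _ (expR_gt0 _)) => [|f]; last by rewrite ZE expR_ge0.
  apply: ler_mass => [|f _ sum_ge]; first by case: dpN.
  by rewrite ZE ler_expR ler_pdivlMr.
rewrite (expect_prod (fun=> p) (fun _ x => expR (a x / eta))) prodr_const card_ord.
apply: (@le_trans _ _ (expR (1 / 2) ^+ N / expR N%:R)); last first.
  by rewrite -expRM_natr -expRB ler_expR; lra.
rewrite ler_pM2r ?invr_gt0 ?expR_gt0 //.
rewrite lerXn2r ?nnegrE ?expR_ge0 ?expect_expR_le //.
by apply: expect_ge0 => // x; apply: expR_ge0.
Qed.

End Chernoff.

Lemma exists_sample_small_means T (G : finType) N (p : T -> R) (a : G -> T -> R)
    (b mu eta : R) :
  (0 < N)%N -> distr p -> (forall g x, 0 <= a g x <= b) ->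
  (forall g, expect p (a g) <= mu) -> 0 < eta ->
  mu * expR (b / eta) <= eta / 2 -> #|G|%:R * expR (- (N%:R / 2)) < 1 :> R ->
  exists f : {ffun 'I_N -> T}, forall g, expect (empirical f) (a g) < eta.
Proof.
move=> N0 dp ab mean_a eta0 mu_small few; apply: contrapT => /forallNP bad.
have {}bad (f : {ffun 'I_N -> T}) : exists g, N%:R * eta <= \sum_i a g (f i).
  have /existsNP[g /negP] := bad f; rewrite -leNgt expect_empirical => le_eta.
  by exists g; rewrite mulrC -ler_pdivlMr ?ltr0n.
pose P := prod_distr (fun _ : 'I_N => p); have dP : distr P by apply: distr_prod.
pose B g (f : {ffun 'I_N -> T}) := N%:R * eta <= \sum_i a g (f i).
suff : 1 <= #|G|%:R * expR (- (N%:R / 2)) :> R by rewrite leNgt few.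
apply: (@le_trans _ _ (\sum_g mass P (B g))); last first.
  rewrite mulr_natl -sumr_const; apply: ler_sum => g _.
  exact: sample_mean_tail (mean_a g) eta0 mu_small.
under eq_bigr do rewrite massE.
rewrite -expect_sum -[leLHS](expect_cst 1 dP); apply: ler_expect => // f.
have [g Bg] := bad f; rewrite (bigD1 g) //= /B Bg lerDl.
by apply: sumr_ge0.
Qed.

Definition iid_distr T n (p : {ffun T -> R}) : {ffun {ffun 'I_n -> T} -> R} :=
  [ffun xn => prod_distr (fun=> p) xn].

Lemma expect_iid T n (p : {ffun T -> R}) F :
  expect (iid_distr n p) F = expect (prod_distr (fun _ : 'I_n => p)) F.
Proof. by apply: eq_bigr => xn _; rewrite ffunE. Qed.

Lemma prob_iid T n (p : {ffun T -> R}) : prob p -> prob (iid_distr n p).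
Proof.
move=> prob_p; have [p0 p1] := distr_prod (fun _ : 'I_n => prob_p).
split=> [xn|]; first by rewrite ffunE.
by rewrite -[RHS]p1; apply: eq_bigr => xn _; rewrite ffunE.
Qed.

End Sampling.

Section HilbertSchmidt.
Local Open Scope complex_scope.
Variable R : realType.
Local Notation C := (R[i]).
Local Notation Re := (@complex.Re R).
Local Notation Im := (@complex.Im R).

Fact Re_is_zmod_morphism : zmod_morphism (Re : C -> R).
Proof. by case=> a b [c e]. Qed.
HB.instance Definition _ := GRing.isZmodMorphism.Build C R Re Re_is_zmod_morphism.

Fact Im_is_zmod_morphism : zmod_morphism (Im : C -> R).
Proof. by case=> a b [c e]. Qed.
HB.instance Definition _ := GRing.isZmodMorphism.Build C R Im Im_is_zmod_morphism.

Lemma Re_realM (a : R) (x : C) : Re (a%:C * x) = a * Re x.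
Proof. by case: x => b c /=; rewrite mul0r subr0. Qed.

Lemma Im_realM (a : R) (x : C) : Im (a%:C * x) = a * Im x.
Proof. by case: x => b c /=; rewrite mul0r addr0. Qed.

Lemma Re_conjM (x y : C) : Re (conjc x * y) = Re x * Re y + Im x * Im y.
Proof. by case: x => a b; case: y => c e /=; rewrite mulNr opprK. Qed.

Fact adj_is_zmod_morphism m n : zmod_morphism (@adj R m n).
Proof. by move=> A B; apply/matrixP => i j; rewrite /adj !mxE rmorphB. Qed.
HB.instance Definition _ m n :=
  GRing.isZmodMorphism.Build _ _ (@adj R m n) (@adj_is_zmod_morphism m n).

Lemma adjB m n (A B : 'M[C]_(m, n)) : adj (A - B) = adj A - adj B.
Proof. exact: raddfB. Qed.

Lemma adj_sum m n (I : Type) (r : seq I) (P : pred I) (F : I -> 'M[C]_(m, n)) :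
  adj (\sum_(i <- r | P i) F i) = \sum_(i <- r | P i) adj (F i).
Proof. exact: raddf_sum. Qed.

Lemma adjE m n (A : 'M[C]_(m, n)) i j : adj A i j = conjc (A j i).
Proof. by rewrite /adj !mxE. Qed.

Lemma adjK m n (A : 'M[C]_(m, n)) : adj (adj A) = A.
Proof. by apply/matrixP => i j; rewrite !adjE conjcK. Qed.

Lemma adjM m n p (A : 'M[C]_(m, n)) (B : 'M[C]_(n, p)) :
  adj (A *m B) = adj B *m adj A.
Proof. by rewrite /adj trmx_mul map_mxM. Qed.

Lemma adjZ m n (a : R) (A : 'M[C]_(m, n)) : adj (a%:C *: A) = a%:C *: adj A.
Proof. by apply/matrixP => i j; rewrite /adj !mxE rmorphM /= oppr0. Qed.

Lemma adj1 n : adj (1%:M : 'M[C]_n) = 1%:M.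
Proof. by rewrite /adj trmx1 map_mx1. Qed.

Lemma unitarymx_adjP d (U : 'M[C]_d) :
  reflect (U *m adj U = 1%:M) (U \is unitarymx).
Proof. exact: unitarymxP. Qed.

Lemma adj_mul_unitary d (U : 'M[C]_d) : U \is unitarymx -> adj U *m U = 1%:M.
Proof. by move/unitarymx_adjP/mulmx1C. Qed.

Definition rtr d (A : 'M[C]_d) : R := Re (\tr A).

Fact rtr_is_zmod_morphism d : zmod_morphism (@rtr d).
Proof. by move=> A B; rewrite /rtr !raddfB. Qed.
HB.instance Definition _ d :=
  GRing.isZmodMorphism.Build _ _ (@rtr d) (@rtr_is_zmod_morphism d).

Lemma rtrD d (A B : 'M[C]_d) : rtr (A + B) = rtr A + rtr B.
Proof. exact: raddfD. Qed.

Lemma rtrB d (A B : 'M[C]_d) : rtr (A - B) = rtr A - rtr B.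
Proof. exact: raddfB. Qed.

Lemma rtr_sum d (I : Type) (r : seq I) (P : pred I) (F : I -> 'M[C]_d) :
  rtr (\sum_(i <- r | P i) F i) = \sum_(i <- r | P i) rtr (F i).
Proof. exact: raddf_sum. Qed.

Lemma rtr0 d : rtr (0 : 'M[C]_d) = 0.
Proof. exact: raddf0. Qed.

Lemma rtrZ d (a : R) (A : 'M[C]_d) : rtr (a%:C *: A) = a * rtr A.
Proof. by rewrite /rtr mxtraceZ Re_realM. Qed.

Lemma rtrC m n (A : 'M[C]_(m, n)) (B : 'M[C]_(n, m)) :
  rtr (A *m B) = rtr (B *m A).
Proof. by rewrite /rtr mxtrace_mulC. Qed.

Lemma rtr1 d : rtr (1%:M : 'M[C]_d) = d%:R.
Proof. by rewrite /rtr mxtrace1 raddfMn. Qed.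

Lemma rtr_adj d (A : 'M[C]_d) : rtr (adj A) = rtr A.
Proof.
rewrite /rtr /mxtrace !raddf_sum; apply: eq_bigr => i _ /=.
by rewrite adjE; case: (A i i).
Qed.

Definition hsnorm2 m n (A : 'M[C]_(m, n)) : R := rtr (adj A *m A).

Lemma rtr_adj_mul m n (A B : 'M[C]_(m, n)) :
  rtr (adj A *m B) =
  \sum_i \sum_j (Re (A i j) * Re (B i j) + Im (A i j) * Im (B i j)).
Proof.
rewrite exchange_big /rtr /mxtrace raddf_sum; apply: eq_bigr => j _ /=.
rewrite mxE raddf_sum; apply: eq_bigr => i _ /=.
by rewrite adjE Re_conjM.
Qed.

Lemma hsnorm2E m n (A : 'M[C]_(m, n)) :
  hsnorm2 A = \sum_i \sum_j (Re (A i j) ^+ 2 + Im (A i j) ^+ 2).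
Proof. exact: rtr_adj_mul. Qed.

Lemma hsnorm2_ge0 m n (A : 'M[C]_(m, n)) : 0 <= hsnorm2 A.
Proof.
rewrite hsnorm2E; do 2!(apply: sumr_ge0 => ? _).
by rewrite addr_ge0 ?sqr_ge0.
Qed.

Lemma hsnorm2_eq0 m n (A : 'M[C]_(m, n)) : hsnorm2 A = 0 -> A = 0.
Proof.
rewrite hsnorm2E => A0; apply/matrixP => i j; rewrite mxE.
have sq0 k l : 0 <= Re (A k l) ^+ 2 + Im (A k l) ^+ 2.
  by rewrite addr_ge0 ?sqr_ge0.
have row0 := psumr_eq0P (fun k _ => sumr_ge0 _ (fun l _ => sq0 k l)) A0.
have /eqP : Re (A i j) ^+ 2 + Im (A i j) ^+ 2 = 0.
  by apply: (psumr_eq0P _ (row0 i isT)).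
rewrite paddr_eq0 ?sqr_ge0 // !sqrf_eq0.
by case: (A i j) => a b /andP[/eqP /= -> /eqP ->].
Qed.

Lemma hsnorm2_adj m n (A : 'M[C]_(m, n)) : hsnorm2 (adj A) = hsnorm2 A.
Proof. by rewrite /hsnorm2 adjK rtrC. Qed.

Lemma hsnorm2Z m n (a : R) (A : 'M[C]_(m, n)) :
  hsnorm2 (a%:C *: A) = a ^+ 2 * hsnorm2 A.
Proof. by rewrite /hsnorm2 adjZ -scalemxAl -scalemxAr !rtrZ mulrA. Qed.

Lemma hsnorm2B m n (A B : 'M[C]_(m, n)) :
  hsnorm2 (A - B) = hsnorm2 A + hsnorm2 B - 2 * rtr (adj A *m B).
Proof.
rewrite !hsnorm2E rtr_adj_mul mulr_sumr -big_split -sumrB; apply: eq_bigr => i _ /=.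
rewrite mulr_sumr -big_split -sumrB; apply: eq_bigr => j _ /=.
by rewrite !mxE !raddfB /=; ring.
Qed.

Lemma rtr_cauchy_schwarz m n (A : 'M[C]_(m, n)) (B : 'M[C]_(n, m)) :
  `|rtr (A *m B)| <= Num.sqrt (hsnorm2 A * hsnorm2 B).
Proof.
rewrite sqrtrM ?hsnorm2_ge0 //.
set a := Num.sqrt (hsnorm2 A); set b := Num.sqrt (hsnorm2 B).
have a2 : a ^+ 2 = hsnorm2 A by rewrite sqr_sqrtr ?hsnorm2_ge0.
have b2 : b ^+ 2 = hsnorm2 B by rewrite sqr_sqrtr ?hsnorm2_ge0.
have [A0|a0] := eqVneq a 0.
  have -> : A = 0 by apply: hsnorm2_eq0; rewrite -a2 A0 expr0n.
  by rewrite mul0mx rtr0 normr0 mulr_ge0 ?sqrtr_ge0.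
have [B0|b0] := eqVneq b 0.
  have -> : B = 0 by apply: hsnorm2_eq0; rewrite -b2 B0 expr0n.
  by rewrite mulmx0 rtr0 normr0 mulr_ge0 ?sqrtr_ge0.
have ab0 : 0 < a * b by rewrite mulr_gt0 // lt_def ?a0 ?b0 sqrtr_ge0.
have expand (s : R) : hsnorm2 (b%:C *: adj A - (s * a)%:C *: B) =
    (a * b) ^+ 2 + (s * a * b) ^+ 2 - 2 * (s * a * b) * rtr (A *m B).
  rewrite hsnorm2B !hsnorm2Z hsnorm2_adj adjZ adjK -scalemxAl -scalemxAr !rtrZ.
  by rewrite -a2 -b2; ring.
rewrite ler_norml; apply/andP; split; rewrite -(ler_pM2l ab0).
  by have := hsnorm2_ge0 (b%:C *: adj A - (-1 * a)%:C *: B); rewrite expand; lra.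
by have := hsnorm2_ge0 (b%:C *: adj A - (1 * a)%:C *: B); rewrite expand; lra.
Qed.

End HilbertSchmidt.

Section SpectralCalculus.
Local Open Scope complex_scope.
Variable R : realType.
Local Notation C := (R[i]).
Local Notation Re := (@complex.Re R).
Variable d : nat.
Implicit Types (A B P U : 'M[C]_d) (w v : 'I_d -> R) (f g : R -> R).

Definition unitary_diag U w : 'M[C]_d :=
  U *m diag_mx (\row_a (w a)%:C) *m adj U.

Lemma eq_unitary_diag U w v : w =1 v -> unitary_diag U w = unitary_diag U v.
Proof. by move=> wv; congr (unitary_diag U _); apply: funext. Qed.

Lemma adj_diag_real w :
  adj (diag_mx (\row_a (w a)%:C) : 'M[C]_d) = diag_mx (\row_a (w a)%:C).
Proof.
apply/matrixP => i j; rewrite adjE !mxE eq_sym.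
by case: eqP => [->|_]; rewrite ?mulr1n ?mulr0n /= oppr0.
Qed.

Lemma adj_unitary_diag U w : adj (unitary_diag U w) = unitary_diag U w.
Proof. by rewrite /unitary_diag !adjM adjK adj_diag_real mulmxA. Qed.

Lemma unitary_diagM U w v : U \is unitarymx ->
  unitary_diag U w *m unitary_diag U v = unitary_diag U (fun a => w a * v a).
Proof.
move=> /adj_mul_unitary UU; rewrite /unitary_diag !mulmxA -(mulmxA (U *m _)) UU.
rewrite mulmx1 -(mulmxA U) mulmx_diag; congr (_ *m diag_mx _ *m _).
by apply/rowP => a; rewrite !mxE -rmorphM.
Qed.

Lemma unitary_diagD U w v :
  unitary_diag U w + unitary_diag U v = unitary_diag U (fun a => w a + v a).
Proof.
rewrite /unitary_diag -mulmxDl -mulmxDr -raddfD; congr (_ *m diag_mx _ *m _).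
by apply/rowP => a; rewrite !mxE -rmorphD.
Qed.

Lemma unitary_diagZ U (c : R) w :
  c%:C *: unitary_diag U w = unitary_diag U (fun a => c * w a).
Proof.
rewrite /unitary_diag scalemxAl scalemxAr -linearZ; congr (_ *m diag_mx _ *m _).
by apply/rowP => a; rewrite !mxE -rmorphM.
Qed.

Lemma unitary_diag1 U : U \is unitarymx -> unitary_diag U (fun=> 1) = 1%:M.
Proof.
move=> /unitarymx_adjP UU; rewrite /unitary_diag -[RHS]UU; congr (_ *m _).
rewrite (_ : (\row_a _) = const_mx 1) ?diag_const_mx ?mulmx1 //.
by apply/rowP => a; rewrite !mxE.
Qed.

(* Outcome probabilities of measuring [A] in the orthonormal basis of the
   columns of [U] (Born's rule). *)
Definition born U A (a : 'I_d) : R := Re ((adj U *m A *m U) a a).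

Lemma rtr_mul_unitary_diag A U w :
  rtr (A *m unitary_diag U w) = expect (born U A) w.
Proof.
rewrite /unitary_diag mulmxA rtrC !mulmxA /rtr /mxtrace raddf_sum.
by apply: eq_bigr => a _ /=; rewrite /born mul_mx_diag !mxE mulrC Re_realM mulrC.
Qed.

Lemma rtr_unitary_diag U w : U \is unitarymx ->
  rtr (unitary_diag U w) = \sum_a w a.
Proof.
move=> UU; rewrite -[unitary_diag U w]mul1mx rtr_mul_unitary_diag.
by apply: eq_bigr => a _; rewrite /born mulmx1 adj_mul_unitary // mxE eqxx mul1r.
Qed.

Lemma spectral_decomposition A : adj A = A ->
  exists U w, U \is unitarymx /\ A = unitary_diag U w.
Proof.
move=> adjA; have hermA : A \is hermsymmx.
  by apply/is_hermitianmxP; rewrite expr0 scale1r -[LHS]adjA.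
have /orthomx_spectralP := hermitian_normalmx hermA.
set P := spectralmx A; set s := spectral_diag A.
have PU : P \is unitarymx := spectral_unitarymx A.
rewrite (invmx_unitary PU) => AE.
exists (adj P), (fun a => Re (s 0 a)); split; first by rewrite trmxC_unitary.
rewrite /unitary_diag adjK {1}AE; congr (_ *m diag_mx _ *m _).
apply/rowP => a; rewrite mxE.
have /mxOverP/(_ 0 a) := hermitian_spectral_diag_real hermA.
by move/RRe_real => ->.
Qed.

Lemma spec_decE A U (l : 'rV[R]_d) :
  spec_dec A U l <-> U \is unitarymx /\ A = unitary_diag U (fun a => l 0 a).
Proof.
rewrite /spec_dec /unitary_diag.
have -> : map_mx (fun r => r%:C) l = \row_a (l 0 a)%:C.
  by apply/rowP => a; rewrite !mxE.
by split=> -[/unitarymx_adjP].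
Qed.

(* Two diagonalisations are intertwined by [adj V *m U], which only couples
   equal eigenvalues; hence [hfun] does not depend on the chosen one. *)
Lemma hfun_unitary_diag f U w : U \is unitarymx ->
  hfun f (unitary_diag U w) = unitary_diag U (fun a => f (w a)).
Proof.
move=> UU; rewrite /hfun; case: pselect => [ex|]; last first.
  case; exists (U, \row_a w a); apply/spec_decE; split=> //=.
  by apply: eq_unitary_diag => a; rewrite mxE.
case: (cid ex) => -[V l] /= /spec_decE /= [VU UwVl].
have -> : map_mx (fun r => (f r)%:C) l = \row_a (f (l 0 a))%:C.
  by apply/rowP => a; rewrite !mxE.
have intertwine : (adj V *m U) *m diag_mx (\row_a (w a)%:C) =
    diag_mx (\row_a (l 0 a)%:C) *m (adj V *m U).
  move: UwVl => /(congr1 (fun B => adj V *m B *m U)); rewrite /unitary_diag !mulmxA.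
  rewrite -(mulmxA _ (adj U)) (adj_mul_unitary UU) mulmx1.
  by rewrite (adj_mul_unitary VU) mul1mx -!mulmxA.
have intertwine_f : (adj V *m U) *m diag_mx (\row_a (f (w a))%:C) =
    diag_mx (\row_a (f (l 0 a))%:C) *m (adj V *m U).
  apply/matrixP => i j; move/matrixP/(_ i j): intertwine.
  rewrite !mul_mx_diag !mul_diag_mx !mxE; set m := \sum_ _ _.
  have [->|m0] := eqVneq m 0; first by rewrite !mul0r !mulr0.
  by rewrite mulrC => /(mulIf m0)[->]; rewrite mulrC.
move/unitarymx_adjP: UU => UU.
rewrite /unitary_diag; move/(congr1 (fun B => V *m B *m adj U)): intertwine_f.
by rewrite !mulmxA (unitarymx_adjP _ VU) mul1mx => ->; rewrite -!mulmxA UU mulmx1.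
Qed.

Lemma eq_hfun f g A : f =1 g -> hfun f A = hfun g A.
Proof. by move=> /funext ->. Qed.

Lemma adj_hfun f A : adj (hfun f A) = hfun f A.
Proof.
rewrite /hfun; case: pselect => [ex|_]; last exact: raddf0.
case: (cid ex) => -[U l] /= _.
have -> : map_mx (fun r => (f r)%:C) l = \row_a (f (l 0 a))%:C.
  by apply/rowP => a; rewrite !mxE.
exact: adj_unitary_diag.
Qed.

Lemma hfunM f g A : adj A = A ->
  hfun f A *m hfun g A = hfun (fun x => f x * g x) A.
Proof.
move=> /spectral_decomposition[U [w [UU ->]]].
by rewrite !hfun_unitary_diag // unitary_diagM.
Qed.

Lemma hfunD f g A : adj A = A -> hfun f A + hfun g A = hfun (fun x => f x + g x) A.
Proof.
move=> /spectral_decomposition[U [w [UU ->]]].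
by rewrite !hfun_unitary_diag // unitary_diagD.
Qed.

Lemma hfunZ (c : R) f A : adj A = A -> c%:C *: hfun f A = hfun (fun x => c * f x) A.
Proof.
move=> /spectral_decomposition[U [w [UU ->]]].
by rewrite !hfun_unitary_diag // unitary_diagZ.
Qed.

Lemma hfunB f g A : adj A = A -> hfun f A - hfun g A = hfun (fun x => f x - g x) A.
Proof.
move=> adjA; apply/eqP; rewrite subr_eq hfunD //; apply/eqP.
by apply: eq_hfun => x; rewrite subrK.
Qed.

Lemma hfun_id A : adj A = A -> hfun id A = A.
Proof.
by move=> /spectral_decomposition[U [w [UU ->]]]; rewrite hfun_unitary_diag.
Qed.

Lemma hfun1 A : adj A = A -> hfun (fun=> 1) A = 1%:M.
Proof.
move=> /spectral_decomposition[U [w [UU ->]]].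
by rewrite hfun_unitary_diag // unitary_diag1.
Qed.

Lemma mlogE A : mlog A = hfun (@log2 R) A.
Proof.
by apply: eq_hfun => x; case: eqP => // ->; rewrite /log2 ln0 ?mul0r.
Qed.

Definition orthoproj P : Prop := adj P = P /\ P *m P = P.

Lemma orthoprojC P : orthoproj P -> orthoproj (1%:M - P).
Proof.
move=> [adjP PP]; split; first by rewrite adjB adj1 adjP.
by rewrite mulmxBl !mulmxBr mul1mx mulmx1 PP mul1mx subrr subr0.
Qed.

Definition specproj (S : pred R) A : 'M[C]_d := hfun (fun x => (S x)%:R) A.

Lemma orthoproj_spec (S : pred R) A : adj A = A -> orthoproj (specproj S A).
Proof.
move=> adjA; split; first exact: adj_hfun.
rewrite /specproj hfunM //; apply: eq_hfun => x.
by case: (S x); rewrite ?mulr1 ?mulr0.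
Qed.

Lemma specprojC (S : pred R) A : adj A = A ->
  1%:M - specproj S A = specproj (predC S) A.
Proof.
move=> adjA; rewrite -(hfun1 adjA) hfunB //.
by apply: eq_hfun => x /=; case: (S x); rewrite ?subrr ?subr0.
Qed.

Lemma specproj_mul (S : pred R) A : adj A = A ->
  specproj S A *m A = hfun (fun x => (S x)%:R * x) A.
Proof. by move=> adjA; rewrite -{2}(hfun_id adjA) hfunM. Qed.

Lemma specproj_comm (S : pred R) A : adj A = A ->
  specproj S A *m A = A *m specproj S A.
Proof.
move=> adjA; rewrite specproj_mul // -{2}(hfun_id adjA) hfunM //.
by apply: eq_hfun => x; rewrite mulrC.
Qed.

End SpectralCalculus.

Section Positivity.
Local Open Scope complex_scope.
Variable R : realType.
Local Notation C := (R[i]).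
Local Notation Re := (@complex.Re R).
Implicit Types (d : nat) (f g : R -> R).

Lemma psd_mul_adj m n (G : 'M[C]_(m, n)) : psd (G *m adj G).
Proof.
move=> v; rewrite mulmxA -mulmxA -{1}[G]adjK -adjM.
rewrite mxE; apply: sumr_ge0 => a _.
by rewrite adjE mulrC mulcJ_ge0.
Qed.

Lemma conjmx_diag_quad d (U A : 'M[C]_d) a :
  (adj U *m A *m U) a a = (adj (col a U) *m A *m col a U) 0 0.
Proof.
rewrite /adj tr_col map_row -row_mul colE mulmxA -row_mul -colE.
by rewrite [RHS]mxE [RHS]mxE.
Qed.

Lemma unitary_diag_entry d (U : 'M[C]_d) (w : 'I_d -> R) a : U \is unitarymx ->
  (adj U *m unitary_diag U w *m U) a a = (w a)%:C.
Proof.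
move=> /adj_mul_unitary UU; rewrite /unitary_diag !mulmxA UU mul1mx -mulmxA UU.
by rewrite mulmx1 !mxE eqxx mulr1n.
Qed.

Lemma psd_unitary_diag_ge0 d (U : 'M[C]_d) (w : 'I_d -> R) a : U \is unitarymx ->
  psd (unitary_diag U w) -> 0 <= w a.
Proof.
move=> UU /(_ (col a U)); rewrite -conjmx_diag_quad unitary_diag_entry //.
by rewrite ler0c.
Qed.

(* ['i (A - adj A)] is hermitian with vanishing quadratic form, hence zero. *)
Lemma psd_adj d (A : 'M[C]_d) : psd A -> adj A = A.
Proof.
move=> psdA; pose H : 'M[C]_d := Complex 0 1 *: (A - adj A).
have adjH : adj H = H.
  apply/matrixP => i j; rewrite /adj /H !mxE.
  by case: (A j i) => a b; case: (A i j) => a' b'; simpc; congr Complex; ring.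
have H_quad0 (v : 'cV[C]_d) : (adj v *m H *m v) 0 0 = 0.
  rewrite /H -scalemxAr -scalemxAl mxE mulmxBr mulmxBl mxE.
  have -> : adj v *m adj A *m v = adj (adj v *m A *m v).
    by rewrite !adjM adjK mulmxA.
  rewrite [X in _ + X]mxE adjE; move: (psdA v); set z := (_ *m _) 0 0.
  case: z => x y; rewrite lecE /= => /andP[/eqP -> _].
  by simpc; congr Complex; ring.
have [U [w [UU HE]]] := spectral_decomposition adjH.
have w0 a : w a = 0.
  have /(congr1 Re) := unitary_diag_entry w a UU.
  by rewrite -HE conjmx_diag_quad H_quad0.
have : H = 0.
  rewrite HE /unitary_diag (_ : (\row_a _) = 0) ?linear0 ?mulmx0 ?mul0mx //.
  by apply/rowP => a; rewrite !mxE w0.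
move/eqP; rewrite /H scaler_eq0 eq_complex /= oner_eq0 andbF /= subr_eq0.
by move/eqP.
Qed.

Lemma psd_spectral d (A : 'M[C]_d) : psd A -> exists U w,
  [/\ U \is unitarymx, A = unitary_diag U w & forall a, 0 <= w a].
Proof.
move=> psdA; have [U [w [UU AE]]] := spectral_decomposition (psd_adj psdA).
by exists U, w; split=> // a; apply: (psd_unitary_diag_ge0 a UU); rewrite -AE.
Qed.

Lemma eq_hfun_psd d (A : 'M[C]_d) f g : psd A ->
  (forall x, 0 <= x -> f x = g x) -> hfun f A = hfun g A.
Proof.
move=> /psd_spectral[U [w [UU -> w0]]] fg; rewrite !hfun_unitary_diag //.
by apply: eq_unitary_diag => a; apply: fg.
Qed.

Lemma hfun_ge0_psd d (A : 'M[C]_d) f : adj A = A -> (forall x, 0 <= f x) ->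
  psd (hfun f A).
Proof.
move=> adjA f0.
rewrite (@eq_hfun _ _ _ (fun x => Num.sqrt (f x) * Num.sqrt (f x))) => [|x].
  by rewrite -hfunM // -{2}adj_hfun; apply: psd_mul_adj.
by rewrite -expr2 sqr_sqrtr.
Qed.

Lemma hfun_psd d (A : 'M[C]_d) f : psd A -> (forall x, 0 <= x -> 0 <= f x) ->
  psd (hfun f A).
Proof.
move=> psdA f0; rewrite (@eq_hfun_psd _ _ _ (fun x => f `|x|)) // => [|x x0].
  by apply: hfun_ge0_psd => [|x]; [apply: psd_adj | apply: f0].
by rewrite ger0_norm.
Qed.

Lemma psd_square_root d (A : 'M[C]_d) : psd A ->
  exists2 G : 'M[C]_d, adj G = G & A = G *m G.
Proof.
move=> psdA; exists (hfun Num.sqrt A); first exact: adj_hfun.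
rewrite hfunM ?psd_adj // -[LHS](hfun_id (psd_adj psdA)).
by apply: eq_hfun_psd => // x x0; rewrite -expr2 sqr_sqrtr.
Qed.

Lemma rtr_psd_ge0 d (A B : 'M[C]_d) : psd A -> psd B -> 0 <= rtr (A *m B).
Proof.
move=> /psd_square_root[G adjG ->] /psd_square_root[H adjH ->].
rewrite (_ : rtr _ = hsnorm2 (G *m H)) ?hsnorm2_ge0 //.
by rewrite /hsnorm2 adjM adjG adjH !mulmxA -rtrC !mulmxA.
Qed.

Lemma ler_rtr_psdB d (P A B : 'M[C]_d) : psd P -> psd (B - A) ->
  rtr (P *m A) <= rtr (P *m B).
Proof. by move=> psdP psdBA; rewrite -subr_ge0 -rtrB -mulmxBr rtr_psd_ge0. Qed.

Lemma psd1 d : psd (1%:M : 'M[C]_d).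
Proof. by have := @psd_mul_adj d d 1%:M; rewrite adj1 mulmx1. Qed.

Lemma psd_rtr_ge0 d (A : 'M[C]_d) : psd A -> 0 <= rtr A.
Proof. by move=> /(rtr_psd_ge0 (@psd1 d)); rewrite mul1mx. Qed.

Lemma ler_rtr_hfun d (P A : 'M[C]_d) f g : psd P -> psd A ->
  (forall x, 0 <= x -> f x <= g x) -> rtr (P *m hfun f A) <= rtr (P *m hfun g A).
Proof.
move=> psdP psdA fg; apply: ler_rtr_psdB => //; rewrite hfunB ?psd_adj //.
by apply: hfun_psd => // x /fg; rewrite subr_ge0.
Qed.

Lemma psd_quad0_mul0 d (A : 'M[C]_d) (v : 'cV[C]_d) : psd A ->
  (adj v *m A *m v) 0 0 = 0 -> A *m v = 0.
Proof.
move=> /psd_square_root[G adjG ->] Gv0.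
rewrite -mulmxA [G *m v]hsnorm2_eq0 ?mulmx0 // /hsnorm2 adjM adjG.
by rewrite mulmxA -(mulmxA _ G G) /rtr /mxtrace big_ord1 Gv0.
Qed.

Lemma psd_sum d (I : finType) (F : I -> 'M[C]_d) : (forall i, psd (F i)) ->
  psd (\sum_i F i).
Proof.
move=> psdF v; rewrite mulmx_sumr mulmx_suml summxE.
by apply: sumr_ge0 => i _; apply: psdF.
Qed.

Lemma psdZ d (c : R) (A : 'M[C]_d) : 0 <= c -> psd A -> psd (c%:C *: A).
Proof.
move=> c0 psdA v; rewrite -scalemxAr -scalemxAl mxE.
by rewrite mulr_ge0 ?ler0c //; apply: psdA.
Qed.

Lemma orthoproj_psd d (P : 'M[C]_d) : orthoproj P -> psd P.
Proof. by move=> [adjP PP]; rewrite -PP -{2}adjP; apply: psd_mul_adj. Qed.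

Lemma ler_rtr_orthoproj d (P A : 'M[C]_d) : orthoproj P -> psd A ->
  rtr (P *m A) <= rtr A.
Proof.
move=> /orthoprojC/orthoproj_psd psdC /(rtr_psd_ge0 psdC).
by rewrite mulmxBl mul1mx rtrB subr_ge0.
Qed.

Lemma orthoproj_rtr_ge0 d (P A : 'M[C]_d) : orthoproj P -> psd A ->
  0 <= rtr (P *m A).
Proof. by move=> /orthoproj_psd; apply: rtr_psd_ge0. Qed.

Lemma orthoproj_compress_psd d (P A : 'M[C]_d) : orthoproj P -> psd A ->
  psd (P *m A *m P).
Proof.
move=> [adjP _] /psd_square_root[G adjG ->].
rewrite (_ : _ *m P = P *m G *m adj (P *m G)); first exact: psd_mul_adj.
by rewrite adjM adjG adjP !mulmxA.
Qed.

Lemma hsnorm2_orthoproj_mull m n (P : 'M[C]_m) (A : 'M[C]_(m, n)) :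
  orthoproj P -> hsnorm2 (P *m A) <= hsnorm2 A.
Proof.
move=> projP; have [adjP PP] := projP.
rewrite /hsnorm2 adjM adjP mulmxA -(mulmxA _ P P) PP -mulmxA rtrC -mulmxA.
rewrite [leRHS]rtrC; apply: ler_rtr_orthoproj => //; exact: psd_mul_adj.
Qed.

Lemma hsnorm2_orthoproj_mulr m n (P : 'M[C]_n) (A : 'M[C]_(m, n)) :
  orthoproj P -> hsnorm2 (A *m P) <= hsnorm2 A.
Proof.
move=> projP; rewrite -hsnorm2_adj adjM -[leRHS]hsnorm2_adj; have [-> _] := projP.
exact: hsnorm2_orthoproj_mull.
Qed.

End Positivity.

Section States.
Local Open Scope complex_scope.
Variable R : realType.
Local Notation C := (R[i]).
Implicit Types (d : nat) (S : pred R).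

Lemma density_rtr d (A : 'M[C]_d) : density A -> rtr A = 1.
Proof. by case=> _; rewrite /rtr => ->. Qed.

Lemma density_adj d (A : 'M[C]_d) : density A -> adj A = A.
Proof. by case=> /psd_adj. Qed.

Lemma density_spectral d (A : 'M[C]_d) : density A -> exists U w,
  [/\ U \is unitarymx, A = unitary_diag U w & distr w].
Proof.
move=> dA; have [/psd_spectral[U [w [UU AE w0]]] _] := dA.
exists U, w; do 2!split=> //.
by rewrite -(rtr_unitary_diag w UU) -AE density_rtr.
Qed.

Lemma hfun_comp d (f g : R -> R) (A : 'M[C]_d) : adj A = A ->
  hfun f (hfun g A) = hfun (f \o g) A.
Proof.
by move=> /spectral_decomposition[U [w [UU ->]]]; rewrite !hfun_unitary_diag.
Qed.

Lemma trnormE d (A : 'M[C]_d) : adj A = A -> trnorm A = rtr (hfun Num.norm A).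
Proof.
move=> adjA; rewrite /trnorm -/(rtr _) adjA; congr rtr.
rewrite -{1 2}(hfun_id adjA) hfunM // hfun_comp //.
by apply: eq_hfun => x /=; rewrite -expr2 sqrtr_sqr.
Qed.

Lemma trnorm_ge0 d (A : 'M[C]_d) : 0 <= trnorm A.
Proof.
rewrite /trnorm -/(rtr _); apply: psd_rtr_ge0; apply: hfun_ge0_psd => [|x].
  by rewrite adjM adjK.
exact: sqrtr_ge0.
Qed.

Lemma rtr_pos_part d (A : 'M[C]_d) : adj A = A -> rtr A = 0 ->
  rtr (hfun (Num.max 0) A) = trnorm A / 2.
Proof.
move=> adjA trA; rewrite (@eq_hfun _ _ _ (fun x => 2^-1 * (`|x| + x))) => [|x].
  by rewrite -hfunZ // rtrZ -hfunD // rtrD hfun_id // trA addr0 trnormE // mulrC.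
by case: (leP 0 x) => x0; [rewrite ger0_norm // | rewrite ltr0_norm //]; lra.
Qed.

Lemma rtr_orthoproj_le_trnorm d (A P : 'M[C]_d) : adj A = A -> rtr A = 0 ->
  orthoproj P -> rtr (P *m A) <= trnorm A / 2.
Proof.
move=> adjA trA projP; rewrite -rtr_pos_part //.
apply: le_trans (ler_rtr_orthoproj projP _); last first.
  by apply: hfun_ge0_psd => // x; rewrite le_max lexx.
apply: ler_rtr_psdB; first exact: orthoproj_psd.
rewrite -{2}(hfun_id adjA) hfunB //; apply: hfun_ge0_psd => // x.
by rewrite subr_ge0 le_max lexx orbT.
Qed.

Lemma trnorm_orthoproj_attained d (A : 'M[C]_d) : adj A = A -> rtr A = 0 ->
  exists2 P, orthoproj P & trnorm A / 2 = rtr (P *m A).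
Proof.
move=> adjA trA; exists (specproj (fun x => 0 <= x) A); first exact: orthoproj_spec.
rewrite -rtr_pos_part // specproj_mul //; congr rtr; apply: eq_hfun => x.
by case: leP => _; rewrite ?mul1r ?mul0r.
Qed.

Lemma ler_rtr_specproj d S S' (A B : 'M[C]_d) : psd A -> psd B ->
  (forall x, 0 <= x -> S x -> S' x) ->
  rtr (specproj S A *m B) <= rtr (specproj S' A *m B).
Proof.
move=> psdA psdB SS'; rewrite rtrC [leRHS]rtrC; apply: ler_rtr_hfun => // x x0.
by rewrite ler_nat; case: (S x) (SS' x x0) => // ->.
Qed.

Lemma rtr_specproj_ge d (A : 'M[C]_d) t : density A -> 0 < t ->
  rtr (specproj (fun x => t <= x) A) <= t^-1.
Proof.
move=> dA t0; have adjA := density_adj dA; have [psdA _] := dA.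
have -> : t^-1 = rtr (1%:M *m hfun (fun x => t^-1 * x) A).
  by rewrite mul1mx -hfunZ // rtrZ hfun_id // density_rtr // mulr1.
rewrite -[specproj _ _]mul1mx; apply: ler_rtr_hfun => // [|x x0]; first exact: psd1.
case: (leP t x) => tx; last by rewrite mulr_ge0 ?invr_ge0 // ltW.
by rewrite ler_pdivlMl // mulr1.
Qed.

Lemma rtr_orthoproj_le1 d (P A : 'M[C]_d) : orthoproj P -> density A ->
  0 <= rtr (P *m A) <= 1.
Proof.
move=> projP dA; have [psdA _] := dA.
by rewrite orthoproj_rtr_ge0 //= -(density_rtr dA) ler_rtr_orthoproj.
Qed.

Definition specmass d S (A : 'M[C]_d) : R := rtr (specproj S A *m A).

Lemma ler_specmass d S S' (A : 'M[C]_d) : psd A ->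
  (forall x, 0 <= x -> S x -> S' x) -> specmass S A <= specmass S' A.
Proof. by move=> psdA; apply: ler_rtr_specproj. Qed.

Lemma specmass_density d S (A : 'M[C]_d) : density A -> 0 <= specmass S A <= 1.
Proof.
move=> dA; apply: rtr_orthoproj_le1 => //.
exact/orthoproj_spec/density_adj.
Qed.

Lemma trnormB_density_le1 d (A B : 'M[C]_d) : density A -> density B ->
  trnorm (A - B) / 2 <= 1.
Proof.
move=> dA dB; have [||P projP ->] := @trnorm_orthoproj_attained d (A - B).
- by rewrite adjB !density_adj.
- by rewrite rtrB !density_rtr ?subrr.
have /andP[_ PA] := rtr_orthoproj_le1 projP dA.
have /andP[PB _] := rtr_orthoproj_le1 projP dB.
by rewrite mulmxBr rtrB; lra.
Qed.

Lemma orthoproj_rowspace d (A : 'M[C]_d) : exists T : 'M[C]_d,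
  [/\ orthoproj T, A *m T = A, exists K, T = K *m A & rtr T = (\rank A)%:R].
Proof.
pose B := schmidt (row_base A).
have BB : B *m adj B = 1%:M.
  by apply/unitarymxP/schmidt_unitarymx/rank_leq_col.
have eqBA : (B :=: A)%MS.
  exact: eqmx_trans (eqmx_schmidt_free (row_base_free A)) (eq_row_base A).
have [D AE] : exists D, A = D *m B by apply/submxP; rewrite eqBA.
have [K BE] : exists K, B = K *m A by apply/submxP; rewrite eqBA.
exists (adj B *m B); split.
- split; first by rewrite adjM adjK.
  by rewrite -mulmxA (mulmxA B) BB mul1mx.
- by rewrite {1}AE -mulmxA (mulmxA B) BB mul1mx.
- by exists (adj B *m K); rewrite -mulmxA -BE.
- by rewrite rtrC BB rtr1.
Qed.

Lemma rtr_orthoproj d (P : 'M[C]_d) : orthoproj P -> rtr P = (\rank P)%:R.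
Proof.
move=> [adjP PP]; have [T [[adjT _] PT [K TE] <-]] := orthoproj_rowspace P.
have TP : T *m P = T by rewrite TE -mulmxA PP.
by rewrite -PT -rtr_adj adjM adjP adjT TP.
Qed.

(* [T] projects onto the span of the ranges of the [E *m P i]. *)
Lemma exists_low_rank_proj d (I : finType) (P : I -> 'M[C]_d) (E : 'M[C]_d) :
  (forall i, orthoproj (P i)) -> orthoproj E ->
  exists T : 'M[C]_d, [/\ orthoproj T, T *m E = T,
    forall i, P i *m T = P i *m E & rtr T <= \sum_i rtr (P i)].
Proof.
move=> projP [adjE EE]; pose A := (\sum_i <<P i *m E>>)%MS.
have [T [projT AT [K TE] rtrT]] := orthoproj_rowspace A.
have [K' AE] : exists K', A = K' *m E.
  by apply/submxP/sumsmx_subP => i _; rewrite genmxE submxMl.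
have TE_T : T *m E = T by rewrite TE AE -!mulmxA EE.
have ET_T : E *m T = T.
  by have [adjT _] := projT; rewrite -[LHS]adjK adjM adjE adjT TE_T.
exists T; split=> // [i|].
  have /submxP[K'' PE] : (P i *m E <= A)%MS.
    by apply: (sumsmx_sup i) => //; rewrite genmxE.
  by rewrite -{1}ET_T mulmxA PE -mulmxA AT.
rewrite rtrT; apply: (@le_trans _ _ (\sum_i \rank (P i *m E))%N%:R).
  rewrite ler_nat; apply: leq_trans (mxrank_sum_leqif _).1 _ => /=.
  by apply: leq_sum => i _; rewrite mxrank_gen.
rewrite natr_sum; apply: ler_sum => i _.
by rewrite rtr_orthoproj // ler_nat mxrankM_maxl.
Qed.

(* [A - P A P = E A + P A E] for [E = 1 - P], and Cauchy-Schwarz applied to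
   [A = G G] bounds both terms. *)
Lemma gentle_measurement d (P T A : 'M[C]_d) : orthoproj P -> orthoproj T ->
  psd A -> rtr A <= 1 ->
  `|rtr (T *m A) - rtr (T *m (P *m A *m P))| <=
  2 * Num.sqrt (rtr ((1%:M - P) *m A)).
Proof.
move=> projP projT psdA trA; set E := 1%:M - P.
have projE : orthoproj E := orthoprojC projP.
have [[adjP PP] [adjT TT] [adjE EE]] := And3 projP projT projE.
have [G adjG AE] := psd_square_root psdA.
have split_A : T *m A - T *m (P *m A *m P) =
    T *m (E *m G) *m G + T *m (P *m G) *m (G *m E).
  rewrite /E AE !(mulmxBl, mulmxBr) !mul1mx !mulmx1 !mulmxA.
  by rewrite [RHS]addrA subrK.
have bound (B D : 'M[C]_d) b c : hsnorm2 B <= b -> hsnorm2 D <= c ->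
    b * c = rtr (E *m A) -> `|rtr (T *m B *m D)| <= Num.sqrt (rtr (E *m A)).
  move=> Bb Dc <-; apply: le_trans (rtr_cauchy_schwarz _ _) _.
  apply: ler_wsqrtr; apply: ler_pM; rewrite ?hsnorm2_ge0 //.
  by apply: le_trans Bb; apply: hsnorm2_orthoproj_mull.
have hsG : hsnorm2 G <= 1 by rewrite /hsnorm2 adjG -AE.
have hsEG : hsnorm2 (E *m G) = rtr (E *m A).
  by rewrite /hsnorm2 adjM adjG adjE mulmxA -(mulmxA _ E E) EE rtrC mulmxA rtrC -AE.
have hsGE : hsnorm2 (G *m E) = rtr (E *m A) by rewrite -hsnorm2_adj adjM adjG adjE.
rewrite -rtrB split_A rtrD mulr_natl mulr2n; apply: le_trans (ler_normD _ _) _.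
apply: lerD.
  by apply: (bound _ _ (rtr (E *m A)) 1); rewrite ?hsEG ?mulr1.
apply: (bound _ _ 1 (rtr (E *m A))); rewrite ?hsGE ?mul1r //.
by apply: le_trans hsG; apply: hsnorm2_orthoproj_mull.
Qed.

End States.

Section Entropy.
Local Open Scope complex_scope.
Variable R : realType.
Local Notation C := (R[i]).
Variable d : nat.
Implicit Types A : 'M[C]_d.

Definition vn_entropy A : R := - rtr (A *m mlog A).

Lemma vn_entropyE (U : 'M[C]_d) (w : 'I_d -> R) : U \is unitarymx ->
  vn_entropy (unitary_diag U w) = expect w (fun a => - log2 (w a)).
Proof.
move=> UU; rewrite /vn_entropy mlogE hfun_unitary_diag // unitary_diagM //.
by rewrite rtr_unitary_diag // -sumrN; apply: eq_bigr => a _; rewrite mulrN.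
Qed.

Lemma vn_entropy_ge0 A : density A -> 0 <= vn_entropy A.
Proof.
move=> /density_spectral[U [w [UU -> dw]]]; rewrite vn_entropyE //.
by apply: expect_ge0 => // a; rewrite oppr_ge0 log2_le0 // distr_le1.
Qed.

(* Gibbs: [- w ln (d w) <= 1 / d - w], and the right-hand sides add up to 0. *)
Lemma vn_entropy_le A : density A -> vn_entropy A <= log2 d%:R.
Proof.
move=> /density_spectral[U [w [UU -> dw]]]; rewrite vn_entropyE //.
have [a0 _] := distr_gt0_exists dw; have [w0 w1] := dw.
have d0 : 0 < d%:R :> R by rewrite ltr0n; apply: leq_ltn_trans (ltn_ord a0).
rewrite -subr_le0 -[X in _ - X](expect_cst _ dw) -expectB.
pose gap a := - (ln (w a) + ln d%:R).
rewrite (@eq_expect _ _ _ _ (fun a => (ln 2)^-1 * gap a)) => [|a]; last first.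
  by rewrite /gap /log2; field; rewrite gt_eqF // ln2_gt0.
rewrite expectZ pmulr_rle0 ?invr_gt0 ?ln2_gt0 //.
apply: (@le_trans _ _ (\sum_a (d%:R^-1 - w a))); last first.
  by rewrite sumrB w1 sumr_const card_ord -[_ *+ _]mulr_natl mulfV ?gt_eqF // subrr.
apply: ler_sum => a _; have := w0 a; rewrite le_eqVlt => /predU1P[<-|wa].
  by rewrite mul0r subr0 invr_ge0 ltW.
have := mulrN_ln_le1 (mulr_gt0 d0 wa); rewrite lnM ?posrE // => gibbs.
rewrite -(ler_pM2l d0) mulrBr mulfV ?gt_eqF // mulrA; apply: le_trans gibbs.
by rewrite [ln d%:R + _]addrC.
Qed.

Lemma rtr_mlog_sqr_le A : density A ->
  rtr (A *m (mlog A *m mlog A)) <= d%:R * log2sq_max R.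
Proof.
move=> /density_spectral[U [w [UU -> dw]]].
rewrite mlogE !hfun_unitary_diag // !unitary_diagM // rtr_unitary_diag //.
rewrite mulr_natl -[d in leRHS]card_ord -sumr_const; apply: ler_sum => a _.
by apply: mul_log2_sqr_le; have [-> _] := dw; rewrite distr_le1.
Qed.

End Entropy.

Section Ensembles.
Local Open Scope complex_scope.
Variables (R : realType) (X : finType) (d : nat).
Local Notation C := (R[i]).
Variable W : X -> 'M[C]_d.
Implicit Types (p q : {ffun X -> R}).

Lemma rtr_avg (B : 'M[C]_d) p :
  rtr (B *m avg W p) = expect p (fun x => rtr (B *m W x)).
Proof.
by rewrite mulmx_sumr rtr_sum; apply: eq_bigr => x _; rewrite -scalemxAr rtrZ.
Qed.

Lemma adj_avg p : (forall x, adj (W x) = W x) -> adj (avg W p) = avg W p.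
Proof.
by move=> adjW; rewrite adj_sum; apply: eq_bigr => x _; rewrite adjZ adjW.
Qed.

Hypothesis densW : forall x, density (W x).

Lemma density_avg p : prob p -> density (avg W p).
Proof.
move=> [p0 p1]; split.
  by apply: psd_sum => x; apply: psdZ => //; case: (densW x).
rewrite raddf_sum -[RHS]/((1 : R)%:C) -p1 rmorph_sum; apply: eq_bigr => x _ /=.
by rewrite mxtraceZ; case: (densW x) => _ ->; rewrite mulr1.
Qed.

Lemma avg_mulmx_eq0 p x (v : 'cV[C]_d) : prob p -> 0 < p x ->
  avg W p *m v = 0 -> W x *m v = 0.
Proof.
move=> [p0 _] px avg_v0; have [psdW _] := densW x.
apply: psd_quad0_mul0 => //.
have quad_ge0 y : 0 <= (p y)%:C * (adj v *m W y *m v) 0 0.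
  by rewrite mulr_ge0 ?ler0c //; have [psdWy _] := densW y; apply: psdWy.
have quad_sum : \sum_y (p y)%:C * (adj v *m W y *m v) 0 0 = 0.
  transitivity ((adj v *m (avg W p *m v)) 0 0); last by rewrite avg_v0 mulmx0 mxE.
  rewrite mulmxA /avg mulmx_sumr mulmx_suml summxE; apply: eq_bigr => y _.
  by rewrite -scalemxAr -scalemxAl [RHS]mxE.
have /eqP : (p x)%:C * (adj v *m W x *m v) 0 0 = 0.
  by apply: (psumr_eq0P _ quad_sum).
by rewrite mulf_eq0 eq_complex /= eqxx andbT gt_eqF // => /eqP.
Qed.

Definition holevo p : R :=
  vn_entropy (avg W p) - expect p (fun x => vn_entropy (W x)).

Lemma mutinfE p : prob p -> mutinf W p = (holevo p)%:E.
Proof.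
move=> dp; have [p0 _] := dp; set sigma := avg W p.
transitivity (\sum_x (p x * (- vn_entropy (W x) - rtr (mlog sigma *m W x)))%:E)%E.
  apply: eq_bigr => x _; have := p0 x; rewrite le_eqVlt => /predU1P[<-|px].
    by rewrite mul0e mul0r.
  rewrite /relent asboolT => [|v]; last exact: avg_mulmx_eq0.
  by rewrite EFinM mulmxBr -/(rtr _) rtrB opprK [rtr (mlog sigma *m _)]rtrC.
rewrite sumEFin -[\sum_x _]/(expect p _) expectB -rtr_avg rtrC addrC.
congr (_ + _)%:E; rewrite -sumrN; apply: eq_bigr => x _; exact: mulrN.
Qed.

End Ensembles.

Section TensorPowers.
Local Open Scope complex_scope.
Variables (R : realType) (d : nat).
Local Notation C := (R[i]).
Implicit Type n : nat.

Fixpoint digits n : 'I_(d ^ n) -> {ffun 'I_n -> 'I_d} :=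
  match n with
  | 0 => fun _ => ffun0 (card_ord 0)
  | n'.+1 => fun b =>
      let ab := mxtens_unindex (cast_ord (expnS d n') b) in
      [ffun k => if unlift ord0 k is Some k' then digits ab.2 k' else ab.1]
  end.

Lemma expn0_ord_eq0 (b : 'I_(d ^ 0)) : b = 0%N :> nat.
Proof. by case: b => m /=; rewrite expn0; case: m. Qed.

Lemma digits_inj n : injective (@digits n).
Proof.
elim: n => [|n IHn] b c /ffunP eq_bc.
  by apply: val_inj; rewrite /= !expn0_ord_eq0.
apply: (@cast_ord_inj _ _ (expnS d n)).
apply: (can_inj (@mxtens_unindexK _ _)).
apply: injective_projections.
  by have := eq_bc ord0; rewrite /= !ffunE unlift_none.
apply: IHn; apply/ffunP => k.
by have := eq_bc (lift ord0 k); rewrite /= !ffunE liftK.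
Qed.

Lemma digits_bij n : bijective (@digits n).
Proof.
by apply: inj_card_bij; [exact: digits_inj | rewrite card_ffun !card_ord].
Qed.

Lemma sum_digits (V : nmodType) n (F : {ffun 'I_n -> 'I_d} -> V) :
  \sum_f F f = \sum_(b : 'I_(d ^ n)) F (digits b).
Proof. by rewrite (reindex (@digits n)) //; apply: onW_bij; exact: digits_bij. Qed.

Lemma tens_famE n (A : 'I_n -> 'M[C]_d) b c :
  tens_fam A b c = \prod_k A k (digits b k) (digits c k).
Proof.
elim: n A b c => [|n IHn] A b c /=.
  by rewrite castmxE big_ord0 mxE /= -val_eqE /= !expn0_ord_eq0.
rewrite castmxE /= mxE IHn big_ord_recl /= !ffunE unlift_none /= !esymK.
by congr (_ * _); apply: eq_bigr => k _; rewrite !ffunE liftK.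
Qed.

Lemma tens_fam_mul n (A B : 'I_n -> 'M[C]_d) :
  tens_fam A *m tens_fam B = tens_fam (fun k => A k *m B k).
Proof.
apply/matrixP => b c; rewrite mxE tens_famE.
transitivity (\sum_e \prod_k (A k (digits b k) (digits e k) *
                               B k (digits e k) (digits c k))).
  by apply: eq_bigr => e _; rewrite !tens_famE -big_split.
rewrite -(sum_digits (fun f =>
  \prod_k (A k (digits b k) (f k) * B k (f k) (digits c k)))).
rewrite -(bigA_distr_bigA (fun k a => A k (digits b k) a * B k a (digits c k))) /=.
by apply: eq_bigr => k _; rewrite mxE.
Qed.

Lemma adj_tens_fam n (A : 'I_n -> 'M[C]_d) :
  adj (tens_fam A) = tens_fam (fun k => adj (A k)).
Proof.
apply/matrixP => b c; rewrite adjE !tens_famE rmorph_prod /=.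
by apply: eq_bigr => k _; rewrite adjE.
Qed.

Lemma tens_fam_diag n (w : 'I_n -> 'I_d -> R) :
  tens_fam (fun k => diag_mx (\row_a (w k a)%:C)) =
  diag_mx (\row_b (\prod_k w k (digits b k))%:C) :> 'M[C]_(d ^ n).
Proof.
apply/matrixP => b c; rewrite tens_famE !mxE.
have [->|bc] := eqVneq b c.
  by rewrite mulr1n rmorph_prod; apply: eq_bigr => k _; rewrite !mxE eqxx mulr1n.
have [k bck] : exists k, digits b k != digits c k.
  apply: contrapT => /forallNP eq_bc; case/eqP: bc; apply: digits_inj.
  by apply/ffunP => k; apply/eqP/negPn/negP/eq_bc.
by rewrite mulr0n (bigD1 k) //= !mxE (negbTE bck) mulr0n mul0r.
Qed.

Lemma tens_fam1 n : tens_fam (fun _ : 'I_n => 1%:M : 'M[C]_d) = 1%:M.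
Proof.
have one_diag m : 1%:M = diag_mx (\row_a (1 : R)%:C) :> 'M[C]_m.
  rewrite (_ : (\row_a _) = const_mx 1) ?diag_const_mx //.
  by apply/rowP => a; rewrite !mxE.
rewrite one_diag tens_fam_diag one_diag; congr diag_mx.
by apply/rowP => b; rewrite !mxE big1.
Qed.

Lemma tens_fam_unitary n (U : 'I_n -> 'M[C]_d) :
  (forall k, U k \is unitarymx) -> tens_fam U \is unitarymx.
Proof.
move=> UU; apply/unitarymx_adjP; rewrite adj_tens_fam tens_fam_mul -tens_fam1.
by congr tens_fam; apply: funext => k; apply/unitarymx_adjP.
Qed.

Lemma tens_fam_unitary_diag n (U : 'I_n -> 'M[C]_d) (w : 'I_n -> 'I_d -> R) :
  tens_fam (fun k => unitary_diag (U k) (w k)) =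
  unitary_diag (tens_fam U) (fun b => \prod_k w k (digits b k)).
Proof. by rewrite /unitary_diag adj_tens_fam -tens_fam_diag !tens_fam_mul. Qed.

Lemma mxtrace_tens_fam n (A : 'I_n -> 'M[C]_d) :
  \tr (tens_fam A) = \prod_k \tr (A k).
Proof.
rewrite bigA_distr_bigA sum_digits; apply: eq_bigr => b _.
exact: tens_famE.
Qed.

Lemma tens_fam_psd n (A : 'I_n -> 'M[C]_d) :
  (forall k, psd (A k)) -> psd (tens_fam A).
Proof.
move=> psdA; have /choice[G GP] k : exists G, adj G = G /\ A k = G *m G.
  by have [G] := psd_square_root (psdA k); exists G.
rewrite (_ : A = fun k => G k *m G k); last by apply: funext => k; case: (GP k).
rewrite -tens_fam_mul -[X in _ *m X](_ : adj (tens_fam G) = _).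
  exact: psd_mul_adj.
by rewrite adj_tens_fam; congr tens_fam; apply: funext => k; case: (GP k).
Qed.

Lemma tens_fam_density n (A : 'I_n -> 'M[C]_d) :
  (forall k, density (A k)) -> density (tens_fam A).
Proof.
move=> densA; split; first by apply: tens_fam_psd => k; case: (densA k).
by rewrite mxtrace_tens_fam big1 // => k _; case: (densA k).
Qed.

Lemma avgn_iid (X : finType) (W : X -> 'M[C]_d) (p : {ffun X -> R}) n :
  avgn W (iid_distr n p) = tens_fam (fun _ : 'I_n => avg W p).
Proof.
apply/matrixP => b c; rewrite tens_famE /avgn summxE.
transitivity (\sum_(xn : {ffun 'I_n -> X}) \prod_k ((p (xn k))%:C *
                 W (xn k) (digits b k) (digits c k))).
  apply: eq_bigr => xn _; rewrite mxE ffunE /Wn tens_famE rmorph_prod.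
  by rewrite -big_split.
rewrite -(bigA_distr_bigA (fun k x => (p x)%:C * W x (digits b k) (digits c k))) /=.
by apply: eq_bigr => k _; rewrite /avg summxE; apply: eq_bigr => x _; rewrite mxE.
Qed.

End TensorPowers.

Section QuantumTypicality.
Local Open Scope complex_scope.
Variables (R : realType) (d : nat).
Local Notation C := (R[i]).
Local Notation Re := (@complex.Re R).

Lemma adj_diag_entry_real (A : 'M[C]_d) a : adj A = A -> A a a = (Re (A a a))%:C.
Proof.
move=> adjA; have : conjc (A a a) = A a a by rewrite -adjE adjA.
by case: (A a a) => x y /= [] yN; congr Complex; lra.
Qed.

Lemma distr_born (V A : 'M[C]_d) : V \is unitarymx -> density A ->
  distr (born V A).
Proof.
move=> UV [psdA trA]; split=> [a|].
  by have := psdA (col a V); rewrite -conjmx_diag_quad lecE => /andP[].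
transitivity (expect (born V A) (fun=> 1)).
  by apply: eq_bigr => a _; rewrite mulr1.
by rewrite -rtr_mul_unitary_diag unitary_diag1 // mulmx1 /rtr trA.
Qed.

Lemma born_tens_fam n (V A : 'I_n -> 'M[C]_d) b : (forall k, adj (A k) = A k) ->
  born (tens_fam V) (tens_fam A) b = \prod_k born (V k) (A k) (digits b k).
Proof.
move=> adjA; rewrite /born adj_tens_fam !tens_fam_mul tens_famE.
rewrite (eq_bigr (fun k => (born (V k) (A k) (digits b k))%:C)) => [|k _].
  by rewrite -rmorph_prod.
by apply: adj_diag_entry_real; rewrite !adjM adjK adjA mulmxA.
Qed.

Lemma born_eq0 (V A : 'M[C]_d) (s : 'I_d -> R) b : V \is unitarymx ->
  (forall v : 'cV_d, unitary_diag V s *m v = 0 -> A *m v = 0) ->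
  s b = 0 -> born V A b = 0.
Proof.
move=> UV kerA sb; rewrite /born conjmx_diag_quad -mulmxA kerA ?mulmx0 ?mxE //.
rewrite colE /unitary_diag -!mulmxA [adj V *m _]mulmxA adj_mul_unitary // mul1mx.
rewrite (_ : diag_mx _ *m _ = 0) ?mulmx0 //; apply/matrixP => i j.
rewrite mul_diag_mx !mxE; case: eqP => [->|]; last by rewrite mulr0.
by rewrite sb mul0r.
Qed.

Lemma rtr_specproj_tens_fam n (S : pred R) (V rho : 'I_n -> 'M[C]_d)
    (s : 'I_n -> 'I_d -> R) :
  (forall k, V k \is unitarymx) -> (forall k, adj (rho k) = rho k) ->
  rtr (specproj S (tens_fam (fun k => unitary_diag (V k) (s k))) *m tens_fam rho) =
  mass (prod_distr (fun k => born (V k) (rho k))) (fun g => S (\prod_k s k (g k))).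
Proof.
move=> UV adj_rho; rewrite tens_fam_unitary_diag rtrC /specproj.
rewrite hfun_unitary_diag ?tens_fam_unitary // rtr_mul_unitary_diag massE.
by rewrite [RHS]/expect sum_digits; apply: eq_bigr => b _; rewrite born_tens_fam.
Qed.

Lemma rtr_specproj_typical m D (A : 'M[C]_d) : density A ->
  rtr (specproj (typical m D) A) <= 2 `^ (D - m).
Proof.
move=> dA; have [psdA _] := dA.
rewrite -opprB powRN; apply: le_trans (rtr_specproj_ge dA (pow2_gt0 _)).
rewrite -[specproj (typical _ _) _]mulmx1 -[specproj (fun x => _ <= x) _]mulmx1.
apply: ler_rtr_specproj => // [|x _ /andP[]//]; exact: psd1.
Qed.

Section MeasuredEnsemble.
Variables (n : nat) (T : finType) (p : 'I_n -> T -> R).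
Variables (rho sigma V : 'I_n -> T -> 'M[C]_d) (s : 'I_n -> T -> 'I_d -> R).
Hypothesis UV : forall i x, V i x \is unitarymx.
Hypothesis sigmaE : forall i x, sigma i x = unitary_diag (V i x) (s i x).

Definition measured_distr i : T * 'I_d -> R :=
  joint_distr (p i) (fun x => born (V i x) (rho i x)).

Lemma expect_measured i (h : R -> R) :
  expect (measured_distr i) (fun xb => h (s i xb.1 xb.2)) =
  expect (p i) (fun x => rtr (rho i x *m hfun h (sigma i x))).
Proof.
rewrite expect_joint; apply: eq_expect => x.
by rewrite sigmaE hfun_unitary_diag // rtr_mul_unitary_diag.
Qed.

Lemma mass_measured (S : pred R) : (forall i x, adj (rho i x) = rho i x) ->
  mass (prod_distr measured_distr) (fun h => S (\prod_i s i (h i).1 (h i).2)) =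
  expect (prod_distr p) (fun f => rtr
    (specproj S (tens_fam (fun i => sigma i (f i))) *m
     tens_fam (fun i => rho i (f i)))).
Proof.
move=> adj_rho; rewrite massE expect_prod_joint; apply: eq_expect => f.
have -> : tens_fam (fun i => sigma i (f i)) =
    tens_fam (fun i => unitary_diag (V i (f i)) (s i (f i))).
  by congr tens_fam; apply: funext.
rewrite rtr_specproj_tens_fam // massE; apply: eq_expect => g; congr (S _)%:R.
by apply: eq_bigr => i _; rewrite ffunE.
Qed.

End MeasuredEnsemble.

(* Measuring in the product of the eigenbases of the [sigma i x] turns [rho]
   into a product distribution, jointly with the random index: this is the
   weak law of large numbers for the logarithms of the measured eigenvalues. *)
Lemma ensemble_typicality n (T : finType) (p : 'I_n -> T -> R)
    (rho sigma : 'I_n -> T -> 'M[C]_d) D :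
  0 < D -> (forall i, distr (p i)) -> (forall i x, density (rho i x)) ->
  (forall i x, psd (sigma i x)) ->
  (forall i x (v : 'cV_d), sigma i x *m v = 0 -> rho i x *m v = 0) ->
  expect (prod_distr p) (fun f => rtr (specproj (predC (typical
      (\sum_i expect (p i) (fun x => rtr (rho i x *m mlog (sigma i x)))) D))
    (tens_fam (fun i => sigma i (f i))) *m tens_fam (fun i => rho i (f i)))) <=
  (\sum_i expect (p i)
    (fun x => rtr (rho i x *m (mlog (sigma i x) *m mlog (sigma i x))))) / D ^+ 2.
Proof.
move=> D0 dp drho psds ker_sub.
have /choice[Vs VsP] (ix : 'I_n * T) : exists Vs : 'M[C]_d * ('I_d -> R),
    [/\ Vs.1 \is unitarymx, sigma ix.1 ix.2 = unitary_diag Vs.1 Vs.2 &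
        forall b, 0 <= Vs.2 b].
  by have [V [s [? ? ?]]] := psd_spectral (psds ix.1 ix.2); exists (V, s).
pose V i x := (Vs (i, x)).1; pose s i x := (Vs (i, x)).2.
have UV i x : V i x \is unitarymx by case: (VsP (i, x)).
have sigmaE i x : sigma i x = unitary_diag (V i x) (s i x) by case: (VsP (i, x)).
have s0 i (xb : T * 'I_d) : 0 <= s i xb.1 xb.2.
  by case: (VsP (i, xb.1)) => _ _; apply.
have dmeasured i : distr (measured_distr p rho V i).
  by apply: distr_joint => // x; apply: distr_born.
have abs_cont i xb : s i xb.1 xb.2 = 0 -> measured_distr p rho V i xb = 0.
  move=> sxb; rewrite /measured_distr /joint_distr (born_eq0 _ _ sxb) ?mulr0 //.
  by move=> u; rewrite -sigmaE; apply: ker_sub.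
have mean_log i : expect (p i) (fun x => rtr (rho i x *m mlog (sigma i x))) =
    expect (measured_distr p rho V i) (fun xb => log2 (s i xb.1 xb.2)).
  rewrite (expect_measured p rho UV sigmaE i (@log2 R)).
  by apply: eq_expect => x; rewrite mlogE.
have mean_log_sqr i :
    expect (p i) (fun x => rtr (rho i x *m (mlog (sigma i x) *m mlog (sigma i x)))) =
    expect (measured_distr p rho V i) (fun xb => log2 (s i xb.1 xb.2) ^+ 2).
  rewrite (expect_measured p rho UV sigmaE i (fun t => log2 t ^+ 2)).
  by apply: eq_expect => x; rewrite mlogE hfunM ?psd_adj.
rewrite -(mass_measured p UV sigmaE) => [|i x]; last exact: density_adj.
rewrite (eq_bigr _ (fun i _ => mean_log i)) (eq_bigr _ (fun i _ => mean_log_sqr i)).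
exact: (prod_distr_typical D0 dmeasured s0 abs_cont).
Qed.

Definition aep_error n (D : R) : R := d%:R * log2sq_max R / (n%:R * D ^+ 2).

Lemma aep_error_ge n (K D : R) : (0 < n)%N -> 0 < D ->
  K <= n%:R * (d%:R * log2sq_max R) -> K / (n%:R * D) ^+ 2 <= aep_error n D.
Proof.
move=> n0 D0 Kn; have nR : 0 < n%:R :> R by rewrite ltr0n.
have -> : aep_error n D = n%:R * (d%:R * log2sq_max R) / (n%:R * D) ^+ 2.
  by rewrite /aep_error; field; rewrite !gt_eqF.
by rewrite ler_pM2r // invr_gt0 exprn_gt0 ?mulr_gt0.
Qed.

Lemma aep_error_ge0 n D : 0 <= aep_error n D.
Proof.
by apply: divr_ge0; apply: mulr_ge0; rewrite ?log2sq_max_ge0 ?sqr_ge0.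
Qed.

Lemma tens_fam_typicality n (rho sigma : 'I_n -> 'M[C]_d) D :
  0 < D -> (forall i, density (rho i)) -> (forall i, psd (sigma i)) ->
  (forall i (v : 'cV_d), sigma i *m v = 0 -> rho i *m v = 0) ->
  rtr (specproj (predC (typical (\sum_i rtr (rho i *m mlog (sigma i))) D))
    (tens_fam sigma) *m tens_fam rho) <=
  (\sum_i rtr (rho i *m (mlog (sigma i) *m mlog (sigma i)))) / D ^+ 2.
Proof.
move=> D0 drho psds ker_sub; pose p (i : 'I_n) (u : unit) : R := 1.
have dp i : distr (p i) by split=> //; rewrite (big_pred1 tt) // => -[].
have expect1 (F : unit -> R) i : expect (p i) F = F tt.
  by rewrite /expect (big_pred1 tt) ?mul1r // => -[].
have := ensemble_typicality D0 dp (fun i _ => drho i) (fun i _ => psds i)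
  (fun i _ => ker_sub i).
rewrite (eq_bigr _ (fun i _ => expect1 _ i)).
rewrite [X in _ <= X / _](eq_bigr _ (fun i _ => expect1 _ i)).
by rewrite expect_cst //; apply: distr_prod.
Qed.

Lemma tens_fam_self_typicality n (rho : 'I_n -> 'M[C]_d) D :
  (0 < n)%N -> 0 < D -> (forall i, density (rho i)) ->
  specmass (predC (typical (- \sum_i vn_entropy (rho i)) (n%:R * D)))
    (tens_fam rho) <= aep_error n D.
Proof.
move=> n0 D0 drho; have nD : 0 < n%:R * D by rewrite mulr_gt0 ?ltr0n.
have psd_rho i : psd (rho i) by case: (drho i).
have := tens_fam_typicality nD drho psd_rho (fun _ _ => id).
rewrite (eq_bigr (fun i => - vn_entropy (rho i))) => [|i _]; last by rewrite opprK.
rewrite sumrN; move=> /le_trans; apply; apply: aep_error_ge => //.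
rewrite mulr_natl -[n in leRHS]card_ord -sumr_const; apply: ler_sum => i _.
exact: rtr_mlog_sqr_le.
Qed.

Section Channel.
Variables (X : finType) (W : X -> 'M[C]_d).
Hypothesis densW : forall x, density (W x).

Lemma Wn_density n (xn : {ffun 'I_n -> X}) : density (Wn W xn).
Proof. exact: tens_fam_density. Qed.

Lemma iid_conditional_typicality n (p : X -> R) D :
  (0 < n)%N -> 0 < D -> distr p ->
  expect (prod_distr (fun _ : 'I_n => p)) (fun xn => specmass (predC (typical
    (- (n%:R * expect p (fun x => vn_entropy (W x)))) (n%:R * D))) (Wn W xn)) <=
  aep_error n D.
Proof.
move=> n0 D0 dp; have nD : 0 < n%:R * D by rewrite mulr_gt0 ?ltr0n.
have psdW x : psd (W x) by case: (densW x).
have mean_log : expect p (fun x => rtr (W x *m mlog (W x))) =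
    - expect p (fun x => vn_entropy (W x)).
  by rewrite /expect -sumrN; apply: eq_bigr => x _; rewrite -mulrN opprK.
have := ensemble_typicality nD (fun _ : 'I_n => dp) (fun _ => densW) (fun _ => psdW)
  (fun _ _ _ => id).
rewrite !sumr_const card_ord mean_log -[X in typical X]mulr_natl mulrN.
move=> /le_trans; apply.
apply: aep_error_ge => //; rewrite -[leLHS]mulr_natl ler_wpM2l //.
by apply: expect_le => // x; apply: rtr_mlog_sqr_le.
Qed.

Lemma output_typicality n (xn : {ffun 'I_n -> X}) D : (0 < n)%N -> 0 < D ->
  rtr (specproj (predC (typical
      (- (n%:R * vn_entropy (avg W (empirical R xn)))) (n%:R * D)))
    (tens_fam (fun _ : 'I_n => avg W (empirical R xn))) *m Wn W xn) <=
  aep_error n D.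
Proof.
move=> n0 D0; have nD : 0 < n%:R * D by rewrite mulr_gt0 ?ltr0n.
have nR : n%:R != 0 :> R by rewrite pnatr_eq0 -lt0n.
set sigma := avg W _; have prob_xn := prob_empirical R xn n0.
have dsigma : density sigma by apply: density_avg.
have sum_rtr (B : 'M[C]_d) : \sum_i rtr (W (xn i) *m B) = n%:R * rtr (sigma *m B).
  rewrite [rtr (sigma *m _)]rtrC rtr_avg expect_empirical mulrC divfK //.
  by apply: eq_bigr => i _; rewrite rtrC.
have := tens_fam_typicality nD (fun i => densW (xn i))
  (fun _ : 'I_n => proj1 dsigma)
  (fun i _ => avg_mulmx_eq0 densW prob_xn (empirical_gt0 R xn i)).
rewrite !sum_rtr -[rtr (sigma *m mlog sigma)]opprK mulrN => /le_trans; apply.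
by apply: aep_error_ge => //; rewrite ler_wpM2l // rtr_mlog_sqr_le.
Qed.

End Channel.

End QuantumTypicality.

Section EmpiricalApproximation.
Local Open Scope complex_scope.
Variables (R : realType) (T : finType) (D M : nat) (p : {ffun T -> R}).
Local Notation C := (R[i]).
Local Notation Re := (@complex.Re R).
Local Notation Im := (@complex.Im R).
Hypothesis M0 : (0 < M)%N.
Hypothesis dp : prob p.

Lemma Re_avg (B : T -> 'M[C]_D) (q : {ffun T -> R}) i j :
  Re (avg B q i j) = expect q (fun x => Re (B x i j)).
Proof.
by rewrite summxE raddf_sum; apply: eq_bigr => x _ /=; rewrite mxE Re_realM.
Qed.

Lemma Im_avg (B : T -> 'M[C]_D) (q : {ffun T -> R}) i j :
  Im (avg B q i j) = expect q (fun x => Im (B x i j)).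
Proof.
by rewrite summxE raddf_sum; apply: eq_bigr => x _ /=; rewrite mxE Im_realM.
Qed.

Lemma empirical_avg_variance (B : T -> 'M[C]_D) :
  expect (prod_distr (fun _ : 'I_M => p))
    (fun f => hsnorm2 (avg B p - avg B (empirical R f))) <=
  expect p (fun x => hsnorm2 (B x)) / M%:R.
Proof.
rewrite (eq_expect _ (fun x => hsnorm2E (B x))) expect_sum mulr_suml.
rewrite (eq_expect _ (fun f => hsnorm2E _)) expect_sum; apply: ler_sum => i _.
rewrite !expect_sum mulr_suml; apply: ler_sum => j _.
rewrite [X in _ <= X / _]expectD mulrDl.
apply: le_trans (lerD (empirical_mean_variance (fun x => Re (B x i j)) M0 dp)
                      (empirical_mean_variance (fun x => Im (B x i j)) M0 dp)).
rewrite -expectD; apply: ler_expect => [|f]; first exact: distr_prod.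
rewrite 2!mxE -!Re_avg -!Im_avg.
by move: (avg B p i j) (avg B (empirical R f) i j) => [x y] [x' y'].
Qed.

Lemma exists_empirical_approximation (K : finType) (B : K -> T -> 'M[C]_D)
    (r : K -> R) (G : R) :
  (forall k, 0 <= r k) -> (forall x, \sum_k r k * hsnorm2 (B k x) <= G) ->
  exists f : {ffun 'I_M -> T}, forall k,
    r k * hsnorm2 (avg (B k) p - avg (B k) (empirical R f)) <= G / M%:R.
Proof.
move=> r0 BG; have MR : 0 < M%:R :> R by rewrite ltr0n.
pose err k (f : {ffun 'I_M -> T}) :=
  hsnorm2 (avg (B k) p - avg (B k) (empirical R f)).
have [|f sum_le] := expect_le_exists (F := fun f => \sum_k r k * err k f)
    (c := G / M%:R) (distr_prod (fun _ : 'I_M => dp)).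
  rewrite expect_sum.
  apply: (@le_trans _ _
    ((\sum_k r k * expect p (fun x => hsnorm2 (B k x))) / M%:R)).
    rewrite mulr_suml; apply: ler_sum => k _.
    by rewrite expectZ -mulrA ler_wpM2l // empirical_avg_variance.
  rewrite ler_pM2r ?invr_gt0 // (eq_bigr _ (fun k _ => esym (expectZ _ _ _))).
  by rewrite -expect_sum expect_le.
exists f => k; apply: le_trans sum_le; rewrite (bigD1 k) //= lerDl.
by apply: sumr_ge0 => l _; rewrite mulr_ge0 // hsnorm2_ge0.
Qed.

End EmpiricalApproximation.

Section SoftCovering.
Local Open Scope complex_scope.
Variables (R : realType) (T K : finType) (D : nat).
Local Notation C := (R[i]).
Variables (W : T -> 'M[C]_D) (typ : T -> K) (Pi : K -> 'M[C]_D).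
Variables (theta : T -> R) (delta G : R).
Hypothesis densW : forall x, density (W x).
Hypothesis projPi : forall k, orthoproj (Pi k).
Hypothesis theta0 : forall x, 0 <= theta x.
Hypothesis large_le : forall x, specmass (fun t => theta x < t) (W x) <= delta.
Hypothesis outside_le : forall x, rtr ((1%:M - Pi (typ x)) *m W x) <= delta.
Hypothesis size_le : forall x, rtr (Pi (typ x)) * theta x <= G.

Definition cut_state x : 'M[C]_D := specproj (fun t => t <= theta x) (W x) *m W x.

Definition compressed_state x : 'M[C]_D := Pi (typ x) *m cut_state x *m Pi (typ x).

Lemma cut_stateE x :
  cut_state x = hfun (fun t : R => (t <= theta x)%R%:R * t) (W x).
Proof. by rewrite /cut_state specproj_mul ?density_adj. Qed.

Lemma cut_state_psd x : psd (cut_state x).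
Proof.
rewrite cut_stateE; apply: hfun_psd => [|t t0]; first by case: (densW x).
by rewrite mulr_ge0.
Qed.

Lemma psdB_cut_state x : psd (W x - cut_state x).
Proof.
have adjW := density_adj (densW x).
rewrite cut_stateE -{1}(hfun_id adjW) hfunB //; apply: hfun_psd => [|t t0].
  by case: (densW x).
by rewrite subr_ge0 ler_piMl // lern1 leq_b1.
Qed.

Lemma rtr_cut_stateB_le (Q : 'M[C]_D) x : orthoproj Q ->
  `|rtr (Q *m W x) - rtr (Q *m cut_state x)| <= delta.
Proof.
move=> projQ; have adjW := density_adj (densW x); have psdB := psdB_cut_state x.
rewrite -rtrB -mulmxBr ger0_norm ?orthoproj_rtr_ge0 //.
apply: le_trans (ler_rtr_orthoproj projQ psdB) _; apply: le_trans (large_le x).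
rewrite -{1}[W x]mul1mx /cut_state -mulmxBl specprojC //.
by apply: ler_specmass => [|t t0 /=]; [case: (densW x) | rewrite -ltNge].
Qed.

Lemma hsnorm2_cut_state x : hsnorm2 (cut_state x) <= theta x.
Proof.
have adjW := density_adj (densW x); have [psdW _] := densW x.
rewrite /hsnorm2 cut_stateE adj_hfun hfunM //.
apply: (@le_trans _ _ (rtr (1%:M *m hfun (fun t => theta x * t) (W x)))); last first.
  by rewrite mul1mx -hfunZ // rtrZ hfun_id // density_rtr // mulr1.
rewrite -[hfun _ _ in leLHS]mul1mx.
apply: ler_rtr_hfun => [|//|t t0]; first exact: psd1.
case: (leP t) => [t_le|_]; last by rewrite !mul0r mulr_ge0.
by rewrite !mul1r ler_wpM2r.
Qed.

Lemma hsnorm2_compressed_state x : hsnorm2 (compressed_state x) <= theta x.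
Proof.
apply: le_trans (hsnorm2_cut_state x).
apply: le_trans (hsnorm2_orthoproj_mulr _ (projPi _)) _.
exact: hsnorm2_orthoproj_mull.
Qed.

Lemma rtr_compressed_stateB_le (Q : 'M[C]_D) x : orthoproj Q ->
  `|rtr (Q *m W x) - rtr (Q *m compressed_state x)| <= delta + 2 * Num.sqrt delta.
Proof.
move=> projQ; rewrite -(subrKA (rtr (Q *m cut_state x))).
apply: le_trans (ler_normD _ _) _; apply: lerD; first exact: rtr_cut_stateB_le.
have psdC : psd (1%:M - Pi (typ x)) by apply/orthoproj_psd/orthoprojC.
apply: le_trans (gentle_measurement (projPi (typ x)) projQ (cut_state_psd x) _) _.
  rewrite -(density_rtr (densW x)) -subr_ge0 -rtrB.
  by apply: psd_rtr_ge0; apply: psdB_cut_state.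
rewrite ler_pM2l //; apply: ler_wsqrtr; apply: le_trans (outside_le x).
by apply: ler_rtr_psdB => //; apply: psdB_cut_state.
Qed.

Variables (M : nat) (p : {ffun T -> R}).
Hypothesis M0 : (0 < M)%N.
Hypothesis dp : prob p.

Lemma exists_compressed_approximation : exists f : {ffun 'I_M -> T},
  forall Q, orthoproj Q ->
    `|expect p (fun x => rtr (Q *m compressed_state x)) -
      expect (empirical R f) (fun x => rtr (Q *m compressed_state x))| <=
    #|K|%:R * Num.sqrt (G / M%:R).
Proof.
pose B k x := if typ x == k then compressed_state x else 0.
have [||f approx] := @exists_empirical_approximation R T D M p M0 dp K B
    (fun k => rtr (Pi k)) G.
- by move=> k; apply/psd_rtr_ge0/orthoproj_psd.
- move=> x; apply: le_trans (size_le x); rewrite (bigD1 (typ x)) //= /B eqxx.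
  rewrite big1 ?addr0 => [|k].
    rewrite ler_wpM2l ?hsnorm2_compressed_state //.
    by apply/psd_rtr_ge0/orthoproj_psd.
  by rewrite eq_sym => /negbTE ->; rewrite /hsnorm2 mulmx0 rtr0 mulr0.
exists f => Q projQ.
have by_type (q : {ffun T -> R}) :
    expect q (fun x => rtr (Q *m compressed_state x)) = \sum_k rtr (Q *m avg (B k) q).
  under eq_bigr do rewrite rtr_avg.
  rewrite -expect_sum; apply: eq_expect => x; rewrite (bigD1 (typ x)) //= /B eqxx.
  by rewrite big1 ?addr0 // => k; rewrite eq_sym => /negbTE ->; rewrite mulmx0 rtr0.
rewrite !by_type -sumrB; apply: le_trans (ler_norm_sum _ _ _) _.
rewrite mulr_natl -sumr_const; apply: ler_sum => k _.
have PiB (q : {ffun T -> R}) : Pi k *m avg (B k) q = avg (B k) q.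
  rewrite /avg mulmx_sumr; apply: eq_bigr => x _; rewrite -scalemxAr /B.
  case: eqP => [<-|_]; last by rewrite mulmx0.
  by rewrite /compressed_state !mulmxA; have [_ ->] := projPi (typ x).
rewrite -rtrB -mulmxBr -(PiB p) -(PiB (empirical R f)) -mulmxBr mulmxA.
apply: le_trans (rtr_cauchy_schwarz _ _) _.
apply: ler_wsqrtr; apply: le_trans (approx k); rewrite ler_wpM2r ?hsnorm2_ge0 //.
apply: le_trans (hsnorm2_orthoproj_mull _ projQ) _.
by rewrite /hsnorm2; have [-> ->] := projPi k.
Qed.

Lemma soft_covering : exists2 q, probM M q & trnorm (avg W p - avg W q) / 2 <=
  2 * (delta + 2 * Num.sqrt delta) + #|K|%:R * Num.sqrt (G / M%:R).
Proof.
have [f approx] := exists_compressed_approximation.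
have dq := prob_empirical R f M0.
exists (empirical R f); first exact: empirical_probM.
have [||Q projQ ->] :=
  @trnorm_orthoproj_attained _ _ (avg W p - avg W (empirical R f)).
- by rewrite adjB !adj_avg // => x; rewrite density_adj.
- by rewrite rtrB !density_rtr ?subrr //; apply: density_avg.
have close (q : {ffun T -> R}) : prob q ->
    `|expect q (fun x => rtr (Q *m W x)) -
      expect q (fun x => rtr (Q *m compressed_state x))| <=
    delta + 2 * Num.sqrt delta.
  by move=> pr_q; apply: ler_norm_expectB => // x; apply: rtr_compressed_stateB_le.
have := close _ dp; have := close _ dq; have := approx _ projQ.
rewrite mulmxBr rtrB !rtr_avg !ler_norml => /andP[_ ?] /andP[? _] /andP[_ ?].
lra.
Qed.

End SoftCovering.

Section LowRankTest.
Local Open Scope complex_scope.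
Variables (R : realType) (D : nat).
Local Notation C := (R[i]).
Implicit Types (rho omega : 'M[C]_D).

Lemma rtr_orthoproj_split (Q rho : 'M[C]_D) t : orthoproj Q -> density rho ->
  0 <= t ->
  rtr (Q *m rho) <= t * rtr Q + specmass (fun x => t < x) rho.
Proof.
move=> projQ drho t0; have adj_rho := density_adj drho; have [psd_rho _] := drho.
pose large x : R := (t < x)%R%:R * x.
have psd_large : psd (hfun large rho).
  by apply: hfun_psd => // x x0; rewrite mulr_ge0.
apply: (@le_trans _ _ (rtr (Q *m hfun (fun x => t * 1 + large x) rho))).
  rewrite -{1}(hfun_id adj_rho); apply: ler_rtr_hfun => // [|x x0].
    exact: orthoproj_psd.
  by rewrite /large mulr1; case: (ltP t x) => xt; rewrite ?mul1r ?mul0r ?addr0 ?lerDr.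
rewrite -hfunD // -hfunZ // hfun1 // mulmxDr rtrD -scalemxAr rtrZ mulmx1.
by rewrite lerD2l /specmass specproj_mul // ler_rtr_orthoproj.
Qed.

Lemma orthoproj_comm_psd (P A : 'M[C]_D) : orthoproj P -> psd A ->
  P *m A = A *m P -> psd (P *m A).
Proof.
move=> projP psdA PA; have -> : P *m A = P *m A *m P.
  by have [_ PP] := projP; rewrite PA -mulmxA PP.
exact: orthoproj_compress_psd.
Qed.

Lemma rtr_low_rank_test (P A E T : 'M[C]_D) : psd A ->
  orthoproj P -> orthoproj E -> orthoproj T ->
  P *m A = A *m P -> P *m T = P *m E ->
  rtr (E *m A) <= rtr (T *m A) + rtr ((1%:M - P) *m A).
Proof.
move=> psdA projP projE projT PA PT.
have [_ PP] := projP; have projPC := orthoprojC projP.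
have psdPA : psd (P *m A) by apply: orthoproj_comm_psd.
have psdPCA : psd ((1%:M - P) *m A).
  by apply: orthoproj_comm_psd => //; rewrite mulmxBl mulmxBr mul1mx mulmx1 PA.
have rtr_compress F : rtr (F *m (P *m A)) = rtr (P *m F *m P *m A).
  by rewrite -{1}PP -mulmxA PA (mulmxA P) mulmxA rtrC !mulmxA.
have splitA F : rtr (F *m A) = rtr (F *m (P *m A)) + rtr (F *m ((1%:M - P) *m A)).
  by rewrite -rtrD -mulmxDr -mulmxDl addrC subrK mul1mx.
rewrite splitA rtr_compress -PT -rtr_compress; apply: lerD.
  rewrite splitA lerDl; exact: (rtr_psd_ge0 (orthoproj_psd projT) psdPCA).
exact: (ler_rtr_orthoproj projE psdPCA).
Qed.

Variables (T : finType) (W : T -> 'M[C]_D).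
Hypothesis densW : forall x, density (W x).

(* If the mixture and [omega] are nearly orthogonal outside [Q], the low-rank
   test of [exists_low_rank_proj] detects it: it sees almost all of the mixture
   there, but, its rank being at most [N / c], almost nothing of [omega], whose
   eigenvalues outside [Q] are below [tau]. *)
Lemma overlap_le_trnorm N (f : {ffun 'I_N -> T}) omega (c tau : R) :
  (0 < N)%N -> 0 < c -> 0 <= tau -> density omega ->
  1 <= trnorm (avg W (empirical R f) - omega) / 2 + N%:R * tau / c +
    expect (empirical R f) (fun x =>
      rtr (specproj (fun t => tau <= t) omega *m W x) +
      specmass (fun t => t < c) (W x)).
Proof.
move=> N0 c0 tau0 domega; have adj_omega := density_adj domega.
have [psd_omega _] := domega; have prob_f := prob_empirical R f N0.
set Q := specproj _ omega; set E := 1%:M - Q; set rho := avg W _.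
have drho : density rho by apply: density_avg.
have projQ : orthoproj Q by apply: orthoproj_spec.
have projE : orthoproj E by apply: orthoprojC.
pose P i := specproj (fun t => c <= t) (W (f i)).
have projP i : orthoproj (P i) by apply/orthoproj_spec/density_adj.
have [S [projS SE PS rtrS]] := exists_low_rank_proj projP projE.
have psdS : psd S by apply: orthoproj_psd.
have rtrS_le : rtr S <= N%:R / c.
  apply: (le_trans rtrS); rewrite mulr_natl -[N in leRHS]card_ord -sumr_const.
  by apply: ler_sum => i _; apply: rtr_specproj_ge.
have S_omega : rtr (S *m omega) <= N%:R * tau / c.
  apply: (@le_trans _ _ (rtr (S *m hfun (fun=> tau * 1) omega))); last first.
    by rewrite -hfunZ // hfun1 // -scalemxAr mulmx1 rtrZ mulrAC mulrC ler_wpM2r.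
  have -> : S *m omega = S *m (E *m omega) by rewrite mulmxA SE.
  rewrite /E (specprojC _ adj_omega) (specproj_mul _ adj_omega).
  apply: ler_rtr_hfun => // x x0 /=; rewrite mulr1.
  by case: (leP tau x) => [_|/ltW x_le]; rewrite ?mul0r ?mul1r.
have S_rho : rtr (S *m rho) <= rtr (S *m omega) + trnorm (rho - omega) / 2.
  have := @rtr_orthoproj_le_trnorm _ _ (rho - omega) S.
  rewrite mulmxBr !rtrB (density_rtr drho) (density_rtr domega) subrr lerBlDl.
  apply=> //.
  by rewrite adjB !density_adj.
have E_rho : rtr (E *m rho) <= rtr (S *m rho) +
    expect (empirical R f) (fun x => specmass (fun t => t < c) (W x)).
  rewrite !rtr_avg -expectD !expect_empirical ler_pM2r ?invr_gt0 ?ltr0n //.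
  apply: ler_sum => i _.
  have [psdWf _] := densW (f i); have adjWf := density_adj (densW (f i)).
  apply: le_trans (rtr_low_rank_test psdWf (projP i) projE projS _ (PS i)) _.
    exact: specproj_comm.
  rewrite lerD2l /P (specprojC _ adjWf); apply: ler_specmass => // x _ /=.
  by rewrite -ltNge.
have : rtr (Q *m rho) + rtr (E *m rho) = 1.
  by rewrite -rtrD -mulmxDl addrC subrK mul1mx density_rtr.
by rewrite expectD -rtr_avg -/rho; lra.
Qed.

Lemma oneshot_converse (p : {ffun T -> R}) N M (c tau t eta e : R) :
  prob p -> (0 < N)%N -> (0 < M)%N -> 0 < c -> 0 < tau -> 0 <= t -> 0 < eta ->
  (t / tau + specmass (fun x => t < x) (avg W p) +
    expect p (fun x => specmass (fun t => t < c) (W x))) * expR (2 / eta) <=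
    eta / 2 ->
  e + N%:R * tau / c + eta <= 1 ->
  (#|T| ^ M)%:R * expR (- (N%:R / 2)) < 1 :> R ->
  exists f : {ffun 'I_N -> T}, forall q, probM M q ->
    e <= trnorm (avg W (empirical R f) - avg W q) / 2.
Proof.
move=> dp N0 M0 c0 tau0 t0 eta0 mean_small error_small few.
pose Q (g : {ffun 'I_M -> T}) :=
  specproj (fun t => tau <= t) (avg W (empirical R g)).
have dg (g : {ffun 'I_M -> T}) : density (avg W (empirical R g)).
  by apply: density_avg => //; apply: prob_empirical.
have projQ g : orthoproj (Q g) by apply/orthoproj_spec/density_adj/dg.
pose a g x := rtr (Q g *m W x) + specmass (fun t => t < c) (W x).
have a_ge0_le2 g x : 0 <= a g x <= 2.
  have := rtr_orthoproj_le1 (projQ g) (densW x).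
  by have := specmass_density (fun t => t < c) (densW x); rewrite /a; lra.
have mean_a g : expect p (a g) <= t / tau +
    specmass (fun x => t < x) (avg W p) +
    expect p (fun x => specmass (fun t => t < c) (W x)).
  rewrite expectD lerD2r -rtr_avg.
  apply: le_trans (rtr_orthoproj_split (projQ g) _ t0) _; first exact: density_avg.
  by rewrite lerD2r ler_wpM2l // rtr_specproj_ge.
have few_g : #|{ffun 'I_M -> T}|%:R * expR (- (N%:R / 2)) < 1 :> R.
  by rewrite card_ffun card_ord.
have [f small_f] :=
  exists_sample_small_means N0 dp a_ge0_le2 mean_a eta0 mean_small few_g.
exists f => q /(probM_empirical M0)[g ->]; have := small_f g.
have := overlap_le_trnorm f N0 c0 (ltW tau0) (dg g).
by rewrite -/(Q g) -/(a g); lra.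
Qed.

End LowRankTest.

Section ResolutionError.
Variables (R : realType) (X : finType) (d : nat).
Local Notation C := (R[i]).
Variable W : X -> 'M[C]_d.
Hypothesis densW : forall x, density (W x).
Implicit Types n M : nat.

Lemma avgn_density n (pn : {ffun {ffun 'I_n -> X} -> R}) :
  prob pn -> density (avgn W pn).
Proof. by apply: density_avg => xn; apply: Wn_density. Qed.

Lemma res_err_le n M (e : R) : 0 <= e ->
  (forall pn : {ffun {ffun 'I_n -> X} -> R}, prob pn -> exists2 qn, probM M qn &
     trnorm (avgn W pn - avgn W qn) / 2 <= e) ->
  res_err W n M <= e.
Proof.
move=> e0 approx; rewrite /res_err; set S := (X in sup X).
have [->|/set0P S0] := eqVneq S set0; first by rewrite sup0.
apply: ge_sup => // _ [pn prob_pn <-].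
have [qn prob_qn dist_le] := approx pn prob_pn.
apply: le_trans dist_le; apply: ge_inf; last by exists qn.
by exists 0 => _ [q _ <-]; rewrite divr_ge0 // trnorm_ge0.
Qed.

Lemma res_err_ge n M (e : R) (pn : {ffun {ffun 'I_n -> X} -> R}) :
  (0 < M)%N -> prob pn ->
  (forall qn, probM M qn -> e <= trnorm (avgn W pn - avgn W qn) / 2) ->
  e <= res_err W n M.
Proof.
move=> M0 prob_pn far; have [x0 _] := distr_gt0_exists prob_pn.
pose q0 := empirical R [ffun _ : 'I_M => x0].
have prob_q0 : probM M q0 by apply: empirical_probM.
apply: (@le_trans _ _ (inf [set trnorm (avgn W pn - avgn W qn) / 2 | qn in
    @probM R {ffun 'I_n -> X} M]%classic)).
  apply: lb_le_inf; first by exists (trnorm (avgn W pn - avgn W q0) / 2); exists q0.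
  by move=> _ [qn prob_qn <-]; exact: far.
apply: ub_le_sup; last by exists pn.
exists 1 => _ [p' prob_p' <-].
apply: (@le_trans _ _ (trnorm (avgn W p' - avgn W q0) / 2)).
  apply: ge_inf; last by exists q0.
  by exists 0 => _ [q _ <-]; rewrite divr_ge0 // trnorm_ge0.
by apply: trnormB_density_le1; apply: avgn_density => //; case: prob_q0.
Qed.

Lemma res_err_ge0 n M : (0 < #|X|)%N -> (0 < M)%N -> 0 <= res_err W n M.
Proof.
move=> /card_gt0P[x _] M0; pose xn := [ffun _ : 'I_n => x].
apply: (@res_err_ge _ _ _ (empirical R [ffun _ : 'I_1 => xn])) => // [|qn _].
  exact: prob_empirical.
by rewrite divr_ge0 // trnorm_ge0.
Qed.

Section Types.
Variables (n : nat) (D : R).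
Hypothesis n0 : (0 < n)%N.
Hypothesis D0 : 0 < D.

Definition type_of_seq (xn : {ffun 'I_n -> X}) : {ffun X -> 'I_n.+1} :=
  [ffun x => inord (\sum_i (xn i == x))].

Definition type_distr (k : {ffun X -> 'I_n.+1}) : {ffun X -> R} :=
  [ffun x => (k x)%:R / n%:R].

Lemma type_distr_of_seq xn : type_distr (type_of_seq xn) = empirical R xn.
Proof.
apply/ffunP => x; rewrite !ffunE inordK ?natr_sum // ltnS.
apply: (@leq_trans (\sum_(i < n) 1)%N); last by rewrite sum1_card card_ord.
by apply: leq_sum => i _; apply: leq_b1.
Qed.

Definition type_proj (k : {ffun X -> 'I_n.+1}) : 'M[C]_(d ^ n) :=
  specproj (typical (- (n%:R * vn_entropy (avg W (type_distr k)))) (n%:R * D))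
    (tens_fam (fun _ : 'I_n => avg W (type_distr k))).

Definition eigenvalue_cutoff (xn : {ffun 'I_n -> X}) : R :=
  2 `^ (- (\sum_i vn_entropy (W (xn i))) + n%:R * D).

Lemma orthoproj_type_proj k : orthoproj (type_proj k).
Proof.
apply: orthoproj_spec; rewrite adj_tens_fam; congr tens_fam; apply: funext => i.
by apply: adj_avg => x; apply: density_adj.
Qed.

Lemma specmass_above_cutoff xn :
  specmass (fun t => eigenvalue_cutoff xn < t) (Wn W xn) <= aep_error d n D.
Proof.
apply: le_trans (tens_fam_self_typicality n0 D0 (fun i => densW (xn i))).
have [psdW _] := Wn_density densW xn.
apply: ler_specmass => // t _ t_gt /=.
by rewrite /typical negb_and -!ltNge t_gt orbT.
Qed.

Lemma rtr_outside_type_proj xn :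
  rtr ((1%:M - type_proj (type_of_seq xn)) *m Wn W xn) <= aep_error d n D.
Proof.
apply: le_trans (output_typicality densW xn n0 D0).
rewrite /type_proj type_distr_of_seq specprojC // adj_tens_fam.
by congr tens_fam; apply: funext => i; apply: adj_avg => x; apply: density_adj.
Qed.

Lemma rtr_type_proj_cutoff_le xn :
  rtr (type_proj (type_of_seq xn)) * eigenvalue_cutoff xn <=
  2 `^ (n%:R * (holevo W (empirical R xn) + 2 * D)).
Proof.
have dsigma := density_avg densW (prob_empirical R xn n0).
have nR : 0 < n%:R :> R by rewrite ltr0n.
rewrite /type_proj type_distr_of_seq /holevo; set S := vn_entropy (avg _ _).
have := rtr_specproj_typical (- (n%:R * S)) (n%:R * D)
  (tens_fam_density (fun _ : 'I_n => dsigma)).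
rewrite -(ler_pM2r (pow2_gt0 (- (\sum_i vn_entropy (W (xn i))) + n%:R * D))).
move=> /le_trans; apply; rewrite -pow2D ler_pow2 expect_empirical.
set T := \sum_i _.
have -> : n%:R * (S - T / n%:R + 2 * D) =
    n%:R * D - - (n%:R * S) + (- T + n%:R * D) by field; rewrite gt_eqF.
by [].
Qed.

End Types.

Lemma res_err_achievability n M (c D : R) : (0 < n)%N -> (0 < M)%N -> 0 < D ->
  (forall p : {ffun X -> R}, prob p -> holevo W p <= c) ->
  res_err W n M <=
    2 * (aep_error d n D + 2 * Num.sqrt (aep_error d n D)) +
    n.+1%:R ^+ #|X| * Num.sqrt (2 `^ (n%:R * (c + 2 * D)) / M%:R).
Proof.
move=> n0 M0 D0 holevo_le; have delta0 := aep_error_ge0 d n D.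
apply: res_err_le => [|pn prob_pn].
  rewrite addr_ge0 // mulr_ge0 ?exprn_ge0 ?sqrtr_ge0 //.
  by rewrite addr_ge0 // mulr_ge0 ?sqrtr_ge0.
have := @soft_covering R {ffun 'I_n -> X} {ffun X -> 'I_n.+1} (d ^ n)
  (Wn W (n := n)) (@type_of_seq n) (type_proj D) (eigenvalue_cutoff D)
  (aep_error d n D) (2 `^ (n%:R * (c + 2 * D))).
rewrite card_ffun card_ord natrX; apply=> // [xn|k|xn|xn|xn|xn].
- exact: Wn_density.
- exact: orthoproj_type_proj.
- exact: powR_ge0.
- exact: specmass_above_cutoff.
- exact: rtr_outside_type_proj.
- apply: le_trans (rtr_type_proj_cutoff_le D n0 xn) _.
  by rewrite ler_pow2 ler_pM2l ?ltr0n // lerD2r holevo_le //; apply: prob_empirical.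
Qed.

Section IidInput.
Variables (n : nat) (p : {ffun X -> R}) (a : R).
Hypothesis n0 : (0 < n)%N.
Hypothesis prob_p : prob p.
Hypothesis a0 : 0 < a.

Lemma specmass_iid_output_above :
  specmass (fun t => 2 `^ (- (n%:R * (vn_entropy (avg W p) - a))) < t)
    (avgn W (iid_distr n p)) <= aep_error d n a.
Proof.
have dsigma := density_avg densW prob_p.
rewrite avgn_iid; have [psd_sigma _] := tens_fam_density (fun _ : 'I_n => dsigma).
apply: le_trans (tens_fam_self_typicality n0 a0 (fun _ : 'I_n => dsigma)).
apply: ler_specmass => // t _ t_gt; rewrite /= /typical negb_and -!ltNge.
apply/orP; right; apply: le_lt_trans t_gt.
by rewrite ler_pow2 sumr_const card_ord -mulr_natl; lra.
Qed.

Lemma expect_specmass_iid_below :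
  expect (iid_distr n p) (fun xn => specmass
    (fun t => t < 2 `^ (- (n%:R * (expect p (fun x => vn_entropy (W x)) + a))))
    (Wn W xn)) <= aep_error d n a.
Proof.
rewrite expect_iid; have dpn := distr_prod (fun _ : 'I_n => prob_p).
apply: le_trans (iid_conditional_typicality densW n0 a0 prob_p).
apply: (ler_expect dpn) => xn; have [psdW _] := Wn_density densW xn.
apply: ler_specmass => // t _ t_lt; rewrite /= /typical negb_and -!ltNge.
apply/orP; left; apply: (lt_le_trans t_lt).
by rewrite ler_pow2; lra.
Qed.

End IidInput.

Lemma res_err_converse n N M (p : {ffun X -> R}) (a eta e : R) :
  (0 < n)%N -> (0 < N)%N -> (0 < M)%N -> prob p -> 0 < a -> 0 < eta ->
  (2 `^ (- (n%:R * a)) + 2 * aep_error d n a) * expR (2 / eta) <= eta / 2 ->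
  e + N%:R * 2 `^ (- (n%:R * (holevo W p - 3 * a))) + eta <= 1 ->
  2 * #|X|%:R * n%:R * M%:R < N%:R :> R ->
  e <= res_err W n M.
Proof.
move=> n0 N0 M0 prob_p a0 eta0 mean_small error_small few.
have above := specmass_iid_output_above n0 prob_p a0.
have below := expect_specmass_iid_below n0 prob_p a0.
rewrite /holevo in error_small; move: above below error_small.
set S := vn_entropy (avg W p); set H := expect p _ => above below error_small.
have [|||||||f far] := @oneshot_converse R (d ^ n) {ffun 'I_n -> X} (Wn W (n := n))
  (Wn_density densW (n := n)) (iid_distr n p) N M (2 `^ (- (n%:R * (H + a))))
  (2 `^ (- (n%:R * (S - 2 * a)))) (2 `^ (- (n%:R * (S - a)))) eta e
  (prob_iid n prob_p) N0 M0.
- exact: pow2_gt0.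
- exact: pow2_gt0.
- exact: powR_ge0.
- by [].
- apply: le_trans mean_small; rewrite ler_wpM2r ?expR_ge0 // -addrA lerD //.
    by rewrite -powRN -pow2D ler_pow2; lra.
  by rewrite [leRHS]mulr_natl mulr2n; apply: lerD.
- apply: le_trans error_small; rewrite lerD2r lerD2l -mulrA ler_wpM2l //.
  by rewrite -powRN -pow2D ler_pow2; lra.
- rewrite card_ffun card_ord -expnM expRN ltr_pdivrMr ?expR_gt0 // mul1r.
  apply: le_lt_trans (natrX_le_expR _ _ _) _; rewrite ltr_expR natrM; lra.
by apply: (res_err_ge M0 (pn := empirical R f)) => //; apply: prob_empirical.
Qed.

End ResolutionError.

Section Limits.
Local Open Scope classical_set_scope.
Variable R : realType.
Implicit Types (u : nat -> \bar R) (l : \bar R).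

Lemma limn_einf_supE u : limn_einf u = ereal_sup (range (einfs u)).
Proof. by rewrite limn_einf_lim; apply/cvg_lim => //; exact: cvg_einfs_sup. Qed.

Lemma limn_einf_le_near u l :
  (\forall n \near \oo, (u n <= l)%E) -> (limn_einf u <= l)%E.
Proof.
case=> N _ ul; rewrite limn_einf_supE; apply/ereal_supP => _ [m _ <-].
apply: ge_ereal_inf; exists (u (maxn m N)); last by apply: ul; exact: leq_maxr.
by exists (maxn m N) => //; exact: leq_maxl.
Qed.

Lemma limn_einf_ge_near u l :
  (\forall n \near \oo, (l <= u n)%E) -> (l <= limn_einf u)%E.
Proof.
case=> N _ ul; rewrite limn_einf_supE; apply: le_ereal_sup_tmp.
exists (einfs u N); first by exists N.
by apply/ereal_infP => _ [k Nk <-]; exact: ul.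
Qed.

Lemma sqrtr_le (x y : R) : 0 <= y -> x <= y ^+ 2 -> Num.sqrt x <= y.
Proof. by move=> y0 xy; rewrite -(ger0_norm y0) -sqrtr_sqr ler_wsqrtr. Qed.

Lemma sqrt_pow2_ratio_le (n M c D : R) : 0 < M ->
  2 `^ (n * (c + 4 * D)) <= 2 * M ->
  Num.sqrt (2 `^ (n * (c + 2 * D)) / M) <= 2 * 2 `^ (- (n * D)).
Proof.
move=> M0 M_ge; apply: sqrtr_le; first by rewrite mulr_ge0 // powR_ge0.
have -> : 2 `^ (n * (c + 2 * D)) =
    (2 `^ (- (n * D))) ^+ 2 * 2 `^ (n * (c + 4 * D)) :> R.
  by rewrite expr2 -!pow2D; congr (_ `^ _); ring.
rewrite ler_pdivrMr // exprMn -[leRHS]mulrA [leRHS]mulrCA ler_wpM2l ?sqr_ge0 //.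
by apply: le_trans M_ge _; rewrite ler_pM2r //; lra.
Qed.

Lemma exists_nat_between (z : R) : 1 <= z ->
  exists2 N, (0 < N)%N & z < N%:R <= 2 * z.
Proof.
move=> z1; exists (Num.truncn z).+1 => //; rewrite truncnS_gt -natr1.
have : (Num.truncn z)%:R <= z by rewrite truncn_le (le_trans ler01).
by lra.
Qed.

Lemma near_succn (P : set nat) :
  (\forall n \near \oo, P n) -> \forall n \near \oo, P n.+1.
Proof. by case=> N _ NP; exists N => // n /leqW; apply: NP. Qed.

Lemma near_divn_le (A e : R) : 0 < e -> \forall n \near \oo, A / n%:R <= e.
Proof.
move=> e0; near=> n.
have n0 : 0 < n%:R :> R by rewrite ltr0n; near: n; apply: nbhs_infty_gt.
rewrite ler_pdivrMr // mulrC -ler_pdivrMr //.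
by near: n; apply: nbhs_infty_ger.
Unshelve. all: by end_near. Qed.

Lemma near_poly_pow2N_le k (a e : R) : 0 < a -> 0 < e ->
  \forall n \near \oo, n.+1%:R ^+ k * 2 `^ (- (n%:R * a)) <= e.
Proof.
move=> a0 e0; pose b := a * ln 2; have b0 : 0 < b by rewrite mulr_gt0 // ln2_gt0.
pose F : R := (k.+1)`!%:R; have F0 : 0 < F by rewrite ltr0n fact_gt0.
near=> n.
have n0 : (0 < n)%N by near: n; apply: nbhs_infty_gt.
have nR : 0 < n%:R :> R by rewrite ltr0n.
have n_large : 2 ^+ k * F <= n%:R * (b ^+ k.+1 * e).
  rewrite -ler_pdivrMr ?mulr_gt0 ?exprn_gt0 //.
  by near: n; apply: nbhs_infty_ger.
have exp_ge : (n%:R * b) ^+ k.+1 / F <= 2 `^ (n%:R * a).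
  rewrite pow2E -mulrA -/b; apply: le_trans (expR_ge1Dxn k _); first lra.
  by rewrite mulr_ge0 // ltW.
rewrite powRN ler_pdivrMr ?pow2_gt0 //.
apply: (@le_trans _ _ ((2 * n%:R) ^+ k)).
  by rewrite lerXn2r ?nnegrE ?mulr_ge0 // -natrM ler_nat; lia.
apply: (@le_trans _ _ (e * ((n%:R * b) ^+ k.+1 / F))); last by rewrite ler_pM2l.
rewrite mulrA ler_pdivlMr //.
have -> : e * (n%:R * b) ^+ k.+1 = n%:R ^+ k * (n%:R * (b ^+ k.+1 * e)).
  by rewrite exprMn exprS; ring.
by rewrite exprMn [leLHS]mulrAC [leLHS]mulrC ler_pM2l // exprn_gt0.
Unshelve. all: by end_near. Qed.

Lemma near_pow2N_le (a e : R) : 0 < a -> 0 < e ->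
  \forall n \near \oo, 2 `^ (- (n%:R * a)) <= e.
Proof.
move=> a0 e0; apply: filterS (near_poly_pow2N_le 0 a0 e0) => n.
by rewrite expr0 mul1r.
Qed.

Lemma near_linear_le_pow2 (A a : R) : 0 < a ->
  \forall n \near \oo, A * n%:R <= 2 `^ (n%:R * a).
Proof.
move=> a0; have B0 : 0 < 1 + `|A| by rewrite ltr_pwDl.
have := near_poly_pow2N_le 1 a0 (_ : 0 < (1 + `|A|)^-1).
rewrite invr_gt0 => /(_ B0); apply: filterS => n.
rewrite expr1 powRN ler_pdivrMr ?pow2_gt0 // ler_pdivlMl //.
apply: le_trans; apply: (@le_trans _ _ ((1 + `|A|) * n%:R)).
  by rewrite ler_wpM2r //; have := ler_norm A; lra.
by rewrite ler_pM2l // ler_nat.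
Qed.

Lemma near_aep_error_le d (D e : R) : 0 < D -> 0 < e ->
  \forall n \near \oo, aep_error d n D <= e.
Proof.
move=> D0 e0; apply: filterS (near_divn_le (d%:R * log2sq_max R / D ^+ 2) e0) => n.
by rewrite /aep_error -mulrA -invfM [D ^+ 2 * _]mulrC.
Qed.

End Limits.

Section Rates.
Local Open Scope classical_set_scope.
Variables (R : realType) (X : finType) (d : nat) (W : X -> 'M[R[i]]_d).
Hypothesis X_gt0 : (0 < #|X|)%N.
Hypothesis densW : forall x, density (W x).

Lemma holevo_dirac (x : X) : holevo W (empirical R [ffun _ : 'I_1 => x]) = 0.
Proof.
have expectx (F : X -> R) : expect (empirical R [ffun _ : 'I_1 => x]) F = F x.
  by rewrite expect_empirical big_ord1 ffunE divr1.
rewrite /holevo expectx (_ : avg W _ = W x) ?subrr //.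
apply/matrixP => i j; rewrite [LHS]complexE [RHS]complexE.
by rewrite Re_avg Im_avg !expectx.
Qed.

Lemma capacity_ge_holevo p : prob p -> ((holevo W p)%:E <= capacity W)%E.
Proof.
by move=> prob_p; apply: ereal_sup_ubound; exists p => //; apply: mutinfE.
Qed.

Lemma capacity_fin : exists2 c : R, capacity W = c%:E & 0 <= c.
Proof.
have upper : (capacity W <= (log2 d%:R)%:E)%E.
  apply/ereal_supP => _ [p prob_p <-]; rewrite mutinfE // lee_fin /holevo.
  rewrite lerBlDr; apply: le_trans (vn_entropy_le (density_avg densW prob_p)) _.
  by rewrite lerDl expect_ge0 // => x; apply: vn_entropy_ge0.
have lower : (0 <= capacity W)%E.
  have /card_gt0P[x _] := X_gt0.
  rewrite (_ : 0%E = (holevo W (empirical R [ffun _ : 'I_1 => x]))%:E); last first.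
    by rewrite holevo_dirac.
  by apply/capacity_ge_holevo/prob_empirical.
case capE : (capacity W) upper lower => [c| |] // _; rewrite lee_fin => c0.
by exists c.
Qed.

Definition codebook_size (r : R) (n : nat) : nat := Num.truncn (2 `^ (n%:R * r)).

Lemma codebook_size_gt0 r n : 0 <= r -> (0 < codebook_size r n)%N.
Proof.
by move=> r0; rewrite truncn_gt0 -[leLHS](powRr0 2) ler_pow2 mulr_ge0.
Qed.

Lemma achievability (r e : R) : (capacity W < r%:E)%E -> 0 < e ->
  \forall n \near \oo, forall M, (0 < M)%N -> (codebook_size r n <= M)%N ->
    res_err W n M <= e.
Proof.
have [c capE _] := capacity_fin; rewrite capE lte_fin => cr e0.
pose D := (r - c) / 4; have D0 : 0 < D by rewrite divr_gt0 // subr_gt0.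
have holevo_le (p : {ffun X -> R}) : prob p -> holevo W p <= c.
  by move=> /capacity_ge_holevo; rewrite capE lee_fin.
pose u := e / 12; have u0 : 0 < u by rewrite divr_gt0.
near=> n => M M0 size_le.
have n0 : (0 < n)%N by near: n; apply: nbhs_infty_gt.
have MR : 0 < M%:R :> R by rewrite ltr0n.
have delta_le : aep_error d n D <= u.
  by near: n; apply: near_aep_error_le.
have sqrt_delta_le : Num.sqrt (aep_error d n D) <= u.
  apply: sqrtr_le; first exact: ltW.
  by near: n; apply: near_aep_error_le; rewrite ?exprn_gt0.
have poly_le : n.+1%:R ^+ #|X| * 2 `^ (- (n%:R * D)) <= u.
  by near: n; apply: near_poly_pow2N_le.
have M_ge : 2 `^ (n%:R * (c + 4 * D)) <= 2 * M%:R.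
  have -> : c + 4 * D = r by rewrite /D; field.
  apply/ltW/(lt_le_trans (truncnS_gt _)); rewrite -natrM ler_nat mul2n -addnn.
  by rewrite -addn1 leq_add.
have ratio_le := sqrt_pow2_ratio_le MR M_ge.
apply: le_trans (res_err_achievability densW n0 M0 D0 holevo_le) _.
have : n.+1%:R ^+ #|X| * Num.sqrt (2 `^ (n%:R * (c + 2 * D)) / M%:R) <= u * 2.
  apply: le_trans (ler_wpM2l (exprn_ge0 _ (ler0n _ _)) ratio_le) _.
  by rewrite mulrCA mulrC ler_wpM2r.
rewrite (_ : e = 12 * u); last by rewrite /u; field.
by lra.
Unshelve. all: by end_near. Qed.

Lemma strong_converse (r e : R) : (r%:E < capacity W)%E -> e < 1 ->
  \forall n \near \oo, forall M, (0 < M)%N -> (M <= codebook_size r n)%N ->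
    e <= res_err W n M.
Proof.
move=> /ereal_sup_gt[_ [p prob_p <-]]; rewrite mutinfE // lte_fin => r_lt e1.
pose a := (holevo W p - r) / 5; have a0 : 0 < a by rewrite divr_gt0 // subr_gt0.
pose eta := (1 - e) / 2; have eta0 : 0 < eta by rewrite divr_gt0 // subr_gt0.
pose b := eta / 2 / expR (2 / eta) / 3.
have b0 : 0 < b by rewrite divr_gt0 // divr_gt0 ?expR_gt0 // divr_gt0.
near=> n => M M0 M_le.
have n0 : (0 < n)%N by near: n; apply: nbhs_infty_gt.
have MR : M%:R <= 2 `^ (n%:R * r) :> R by rewrite -truncn_ge_nat ?powR_ge0.
have delta_le : aep_error d n a <= b by near: n; apply: near_aep_error_le.
have pow_le_b : 2 `^ (- (n%:R * a)) <= b by near: n; apply: near_pow2N_le.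
have pow_le_eta : 2 `^ (- (n%:R * a)) <= eta / 2.
  by near: n; apply: near_pow2N_le => //; rewrite divr_gt0.
have n_le : 2 * #|X|%:R * n%:R <= 2 `^ (n%:R * a) :> R.
  by near: n; apply: near_linear_le_pow2.
pose z : R := 2 `^ (n%:R * (r + a)).
have z1 : 1 <= z.
  have M1 : 1 <= M%:R :> R by rewrite ler1n.
  apply: (le_trans M1); apply: le_trans MR _; rewrite ler_pow2 ler_wpM2l //.
  by rewrite lerDl ltW.
have [N N0 /andP[zN N2z]] := exists_nat_between z1.
have eE : e = 1 - 2 * eta by rewrite /eta; field.
apply: (@res_err_converse _ _ _ _ densW n N M p a eta e n0 N0 M0 prob_p a0 eta0).
- rewrite -ler_pdivlMr ?expR_gt0 //.
  have -> : eta / 2 / expR (2 / eta) = 3 * b.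
    by rewrite /b; field; rewrite gt_eqF ?expR_gt0.
  by lra.
- suff : N%:R * 2 `^ (- (n%:R * (holevo W p - 3 * a))) <= 2 * 2 `^ (- (n%:R * a)).
    by rewrite eE; lra.
  apply: (@le_trans _ _ (2 * z * 2 `^ (- (n%:R * (holevo W p - 3 * a))))).
    by rewrite ler_pM2r ?pow2_gt0.
  rewrite -mulrA ler_pM2l // /z -pow2D ler_pow2.
  have -> : holevo W p = r + 5 * a by rewrite /a; field.
  by lra.
- apply: le_lt_trans zN.
  rewrite /z mulrDr pow2D [leRHS]mulrC.
  by apply: ler_pM => //; rewrite !mulr_ge0.
Unshelve. all: by end_near. Qed.

Lemma limn_einf_res_err_above (r : R) : 0 <= r -> (capacity W < r%:E)%E ->
  limn_einf (fun n => (res_err W n.+1 (codebook_size r n.+1))%:E) = 0%E.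
Proof.
move=> r0 cap_lt; apply/eqP; rewrite eq_le; apply/andP; split.
  apply/lee_addgt0Pr => e e0; rewrite add0e; apply: limn_einf_le_near.
  apply: filterS (near_succn (achievability cap_lt e0)) => n err_le.
  by rewrite lee_fin err_le ?codebook_size_gt0.
apply: limn_einf_ge_near; apply: nearW => n; rewrite lee_fin.
by rewrite res_err_ge0 ?codebook_size_gt0.
Qed.

Lemma limn_einf_res_err_below (r e : R) : 0 <= r -> (r%:E < capacity W)%E -> e < 1 ->
  (e%:E <= limn_einf (fun n => (res_err W n.+1 (codebook_size r n.+1))%:E))%E.
Proof.
move=> r0 lt_cap e1; apply: limn_einf_ge_near.
apply: filterS (near_succn (strong_converse lt_cap e1)) => n err_ge.
by rewrite lee_fin err_ge ?codebook_size_gt0.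
Qed.

Lemma res_rateE : res_rate W = capacity W.
Proof.
have [c capE c0] := capacity_fin; rewrite capE.
apply/eqP; rewrite eq_le; apply/andP; split.
  apply/lee_addgt0Pr => g g0; apply: ereal_inf_lbound; exists (c + g) => //.
  split=> [|g' g'0]; first by rewrite ltr_wpDl.
  by apply: limn_einf_res_err_above; rewrite ?capE ?lte_fin; lra.
apply/ereal_infP => _ [r [r0 err0] <-]; rewrite lee_fin leNgt; apply/negP => rc.
pose g := (c - r) / 2; have g0 : 0 < g by rewrite divr_gt0 // subr_gt0.
have : ((1 / 2 : R)%:E <= 0)%E; last by rewrite lee_fin; lra.
rewrite -(err0 g g0); apply: limn_einf_res_err_below; last by lra.
  by lra.
by rewrite capE lte_fin /g; lra.
Qed.

Lemma MepsP (eps : R) n M : (0 < M)%N -> res_err W n M <= eps ->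
  [/\ (0 < Meps W eps n)%N, res_err W n (Meps W eps n) <= eps &
      (Meps W eps n <= M)%N].
Proof.
move=> M0 err_le; rewrite /Meps; case: pselect => [ex|]; last by case; exists M.
case: ex_minnP => m /asboolP[m0 err_m] m_min; split=> //.
by apply: m_min; apply/asboolP.
Qed.

Lemma near_Meps_le (eps r : R) : 0 < eps -> (capacity W < r%:E)%E ->
  \forall n \near \oo, [/\ (0 < Meps W eps n)%N,
    res_err W n (Meps W eps n) <= eps & (Meps W eps n)%:R <= 2 `^ (n%:R * r) :> R].
Proof.
move=> eps0 cap_lt; have [c capE c0] := capacity_fin.
have r0 : 0 <= r by move: cap_lt; rewrite capE lte_fin; lra.
apply: filterS (achievability cap_lt eps0) => n err_le.
have size0 := codebook_size_gt0 n r0.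
have [m0 err_m m_le] := MepsP size0 (err_le _ size0 (leqnn _)).
by split=> //; rewrite -truncn_ge_nat ?powR_ge0.
Qed.

Lemma res_rate_epsE (eps : R) : 0 < eps < 1 -> res_rate_eps W eps = capacity W.
Proof.
move=> /andP[eps0 eps1]; have [c capE c0] := capacity_fin.
have cap_lt g : 0 < g -> (capacity W < (c + g)%:E)%E.
  by move=> g0; rewrite capE lte_fin ltrDl.
rewrite /res_rate_eps capE; apply/eqP; rewrite eq_le; apply/andP; split.
  apply/lee_addgt0Pr => g g0; apply: limn_einf_le_near.
  apply: filterS (near_succn (near_Meps_le eps0 (cap_lt g g0))) => n [m0 _ m_le].
  by rewrite -EFinD lee_fin ler_pdivrMr ?ltr0n // mulrC ler_log2_pow2 ?ltr0n.
apply/lee_addgt0Pr => g g0; rewrite -leeBlDr // -EFinB.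
have lt_cap : ((c - g)%:E < capacity W)%E by rewrite capE lte_fin gtrBl.
have mid1 : (1 + eps) / 2 < 1 by lra.
apply: limn_einf_ge_near.
apply: filterS2 (near_succn (near_Meps_le eps0 (cap_lt 1 ltr01)))
  (near_succn (strong_converse lt_cap mid1)) => n [m0 err_m _] far.
rewrite lee_fin ler_pdivlMr ?ltr0n // leNgt; apply/negP => m_lt.
have : (1 + eps) / 2 <= res_err W n.+1 (Meps W eps n.+1); last by lra.
apply: far => //; rewrite truncn_ge_nat ?powR_ge0 //.
by rewrite -ler_log2_pow2 ?ltr0n // mulrC ltW.
Qed.

End Rates.

Theorem theorem1 (R : realType) (X : finType) (d : nat)
  (W : X -> 'M[R[i]]_d) :
  (0 < #|X|)%N ->
  (forall x, density (W x)) ->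
  forall eps : R, 0 < eps < 1 ->
    res_rate W = res_rate_eps W eps /\ res_rate_eps W eps = capacity W.
Proof.
move=> X_gt0 densW eps eps01; rewrite (res_rateE X_gt0 densW).
by rewrite (res_rate_epsE X_gt0 densW eps01).
Qed.
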